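(* There exist universal constants $0<b,d<\infty$ (not depending on $n$, $p$, $c$, $t$) such that for all sufficiently large primes $p$, all integers $n\ge 2$, all real $c>0$ and all integers $t\ge c\,b\,p^2n^4$, and for every starting point $x\in G$, $$4\,\|P_x^{*t}-\mu\|_{T.V.}^2\le d\,e^{-c}.$$
   Context: Let $p$ be an odd prime, $n\ge 2$, and let $G$ be the group of $n\times n$ upper triangular matrices with $1$'s on the diagonal and entries in $\mathbb{Z}/p\mathbb{Z}$ above the diagonal. Let $E(i,i+1)$ be the $n\times n$ matrix with a one in entry $(i,i+1)$ and zeros elsewhere, and $I_n$ the identity matrix. The random walk $P$ on $G$ has one-step transition probabilities $$P_x(xg)=\begin{cases}\frac{1}{2(n-1)}, & \text{if } g=I_n+E(i,i+1)\text{ or } g=I_n-E(i,i+1)\text{ for some }1\le i\le n-1,\\ 0,&\text{otherwise},\end{cases}$$ for $x,g\in G$. The $t$-step probabilities are defined inductively by $P_x^{*1}=P_x$ and $P_x^{*t}(y)=\sum_{w\in G}P_w^{*(t-1)}(y)P_x(w)$. Here $\mu$ is the uniform probability measure on $G$, and the total variation distance is $$\|P_x^{*t}-\mu\|_{T.V.}=\frac12\sum_{g\in G}|P_x^{*t}(g)-\mu(g)|.$$ (Because the walk is invariant under left translation, this distance does not depend on $x$.) *)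

(* Defs.v *)
From HB Require Import structures.
From mathcomp Require Import all_boot all_order all_algebra all_fingroup.
From mathcomp Require Import reals sequences exp.

Set Implicit Arguments.
Unset Strict Implicit.
Unset Printing Implicit Defensive.

Import Order.TTheory GRing.Theory Num.Theory.

Local Open Scope ring_scope.

Definition unitriangular (F : nzRingType) (n : nat) (A : 'M[F]_n) : bool :=
  is_trig_mx A^T && [forall i, A i i == 1].

Lemma unitriangularP (F : nzRingType) (n : nat) (A : 'M[F]_n) :
  reflect (forall i j : 'I_n, (j <= i)%N -> A i j = (i == j)%:R)
          (unitriangular A).
Proof.
apply: (iffP andP) => [[/is_trig_mxP trA /forallP dA] i j | A1].
  rewrite leq_eqVlt => /predU1P[/val_inj-> | ltji].
    by rewrite eqxx; apply/eqP.
  by have := trA _ _ ltji; rewrite mxE => ->; rewrite -val_eqE gtn_eqF.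
split; last by apply/forallP=> i; rewrite A1 ?eqxx.
apply/is_trig_mxP=> i j ltij; rewrite mxE A1; last exact: ltnW.
by rewrite -val_eqE gtn_eqF.
Qed.

Lemma unitriangular1 (F : nzRingType) (n : nat) :
  unitriangular (1%:M : 'M[F]_n).
Proof. by apply/unitriangularP => i j _; rewrite mxE. Qed.

Lemma unitriangularM (F : nzRingType) (n : nat) (A B : 'M[F]_n) :
  unitriangular A -> unitriangular B -> unitriangular (A *m B).
Proof.
move=> /unitriangularP A1 /unitriangularP B1.
apply/unitriangularP => i j leji; rewrite mxE (bigD1 i) //= big1 => [|k neki].
  by rewrite A1 // B1 // eqxx mul1r addr0.
have [ltki | leik] := ltnP k i.
  by rewrite A1 ?(ltnW ltki) // eq_sym (negPf neki) mul0r.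
have ltik : (i < k)%N by rewrite ltn_neqAle leik andbT eq_sym.
by rewrite B1 ?(leq_trans leji) // -val_eqE gtn_eqF ?mulr0 // (leq_ltn_trans leji).
Qed.

Lemma unitriangular_unitmx (F : comUnitRingType) (n : nat) (A : 'M[F]_n) :
  unitriangular A -> A \in unitmx.
Proof.
case/andP=> trA /forallP dA; rewrite unitmxE -det_tr det_trig //.
by rewrite big1 ?unitr1 // => i _; rewrite mxE; apply/eqP.
Qed.

Record unitri (p n : nat) : Type := Unitri {
  unitri_val :> 'M['F_p]_n;
  unitri_valP : unitriangular unitri_val
}.

HB.instance Definition _ (p n : nat) := [isSub for @unitri_val p n].
HB.instance Definition _ (p n : nat) := [Finite of unitri p n by <:].

Section UnitriGroup.

Variables p n : nat.
Implicit Types x y : unitri p n.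

Definition unitri_one : unitri p n := Unitri (unitriangular1 'F_p n).

Definition unitri_mul x y : unitri p n :=
  Unitri (unitriangularM (unitri_valP x) (unitri_valP y)).

Fact unitriangular_inv x : unitriangular (invmx x).
Proof.
have Ux := unitriangular_unitmx (unitri_valP x).
have inj_mul : injective (unitri_mul^~ x).
  by move=> y z /(congr1 val) /= /(can_inj (mulmxK Ux)) /val_inj.
have := injF_onto inj_mul unitri_one => /codomP[y /(congr1 val) /= yx1].
by rewrite -[invmx x]mul1mx yx1 mulmxK //; apply: unitri_valP.
Qed.

Definition unitri_inv x : unitri p n := Unitri (unitriangular_inv x).

Fact unitri_mulP : associative unitri_mul.
Proof. by move=> x y z; apply: val_inj; rewrite /= mulmxA. Qed.

Fact unitri_oneP : left_id unitri_one unitri_mul.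
Proof. by move=> x; apply: val_inj; rewrite /= mul1mx. Qed.

Fact unitri_invP : left_inverse unitri_one unitri_inv unitri_mul.
Proof.
move=> x; apply: val_inj; rewrite /= mulVmx //.
exact/unitriangular_unitmx/unitri_valP.
Qed.

HB.instance Definition _ :=
  Finite_isGroup.Build (unitri p n) unitri_mulP unitri_oneP unitri_invP.

Lemma unitri_1E : unitri_val (1%g : unitri p n) = 1%:M.
Proof. by []. Qed.

Lemma unitri_ME x y : unitri_val (x * y)%g = x *m y.
Proof. by []. Qed.

Lemma unitri_VE x : unitri_val (x^-1)%g = invmx x.
Proof. by []. Qed.

End UnitriGroup.

(* [delta_mx i j] with [j = i + 1] is the matrix E(i,i+1). *)
Definition step_mx (p n : nat) (A : 'M['F_p]_n) : bool :=
  [exists i : 'I_n, exists j : 'I_n,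
    (j == i.+1 :> nat) &&
    ((A == 1%:M + delta_mx i j) || (A == 1%:M - delta_mx i j))].

(* The one-step probability from [x] to [y = x * g], in terms of
   [g = x^-1 * y]; see [walk_mulg]. *)
Definition walk (R : realType) (p n : nat) (x y : unitri p n) : R :=
  if step_mx (x^-1 * y)%g then ((2 * (n - 1))%:R)^-1 else 0.

Lemma walk_mulg (R : realType) (p n : nat) (x g : unitri p n) :
  walk R x (x * g)%g = if step_mx g then ((2 * (n - 1))%:R)^-1 else 0.
Proof. by rewrite /walk mulKg. Qed.

(* [walkn R t x y] is P_x^{*t}(y); the value at [t = 0] is the point mass
   at [x]. *)
Fixpoint walkn (R : realType) (p n t : nat) (x y : unitri p n) : R :=
  match t with
  | 0 => (x == y)%:R
  | 1 => walk R x y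
  | t'.+1 => \sum_(w : unitri p n) walkn R t' w y * walk R x w
  end.

Definition uniform (R : realType) (T : finType) (x : T) : R := #|T|%:R^-1.

Definition tv_dist (R : realType) (T : finType) (f g : T -> R) : R :=
  2^-1 * \sum_(x : T) `|f x - g x|.

(* Main.v *)
From HB Require Import structures.
Require Import Defs.
From mathcomp Require Import all_boot all_order all_algebra all_fingroup.
From mathcomp Require Import ring lra zify.
From mathcomp Require Import reals sequences exp.
Import Order.TTheory GRing.Theory Num.Theory.
Set Implicit Arguments.
Unset Strict Implicit.
Unset Printing Implicit Defensive.
Local Open Scope ring_scope.

(** The distance to uniformity is controlled through the averaging operator [W]
    of the walk, acting on functions on the group. It is enough to show that
    T = 800 p ^ 2 n ^ 4 steps halve the distance of every bounded function to
    its mean, in the supremum norm ([halving]): iterating gives a factor 2 ^ - k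
    after k T steps, whose square is at most exp (- k).

    A function splits into its average over the commutator subgroup N, which
    lives on the abelianization (Z / p) ^ m, with m = n - 1, and the remainder,
    which has no N-invariant part. The two pieces are treated by different
    methods: a spectral gap alone would lose a factor log p on the first one.

    On the abelianization ([abelian_decay]), the walk after t steps varies along
    each generator by at most a constant times the square root of m / t. Indeed
    this variation, multiplied by t / (2 m), is the expectation of the function
    against the signed number of steps along that generator, a martingale of
    variance t / m ([gradient_moment]). Any two elements of the abelianization
    being at distance at most m p, the oscillation is small once t is of the
    order of p ^ 2 m ^ 3.

    On the remainder ([nonabelian_decay]), the quadratic form of the walk
    satisfies a bound 1 - c / (m p) in absolute value ([energy_gap]), which is
    stronger by a factor p than on the abelianization, and this is enough to
    absorb the cardinal of the group when passing from the quadratic norm to the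
    supremum. The gap comes from the following facts about a function that is
    almost invariant, possibly up to a sign, under all the generators I + E(k, k+1).
    - It is almost invariant under I + c E(i, i+2) for all c at a cost of the
      order of the square root of p, since this matrix is a product of two
      commutators of powers of generators with exponents of this size
      ([row_start]).
    - Consider the subgroups of row i obtained by allowing more and more columns,
      starting with column i+2. Conjugation by the generator of index k adds a
      multiple of column k to column k+1. Hence the part of the function that is
      fixed by the columns up to k, but has no part fixed by the columns up to
      k+1, is sent by the generator and by its inverse into two orthogonal parts
      of the preceding layer. An almost invariant function therefore has at most
      about half as much mass in each layer as in the preceding one ([chain_step]),
      and the total mass of the row is bounded independently of n.
    - The subgroups of N made of its first i rows split the remainder into
      pieces, on each of which some row group has no invariants, and since they
      are normal the energies of the pieces add up ([energy_gap]). *)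

(** * Functions on a finite group, translations and averages *)

Section GroupFunctions.
Variables (R : rcfType) (gT : finGroupType).
Local Notation fn := {ffun gT -> R^o}.
Implicit Types (f g h u v w : fn) (x y z s t : gT) (A B C H : {group gT}).

(** Right translation is a left action, by isometries for [dot], and it is the
    only way in which the group acts on functions below. The codomain is the
    regular module [R^o] so that functions form a vector space. *)
Definition shift z f : fn := [ffun x => f (x * z)%g].

Fact shift_linear z : linear (shift z).
Proof. by move=> a f g; apply/ffunP => x; rewrite !ffunE. Qed.
HB.instance Definition _ z :=
  GRing.isLinear.Build R fn fn _ (shift z) (shift_linear z).

Lemma shiftM y z f : shift (y * z) f = shift y (shift z f).
Proof. by apply/ffunP => x; rewrite !ffunE mulgA. Qed.

Lemma shift1 f : shift 1 f = f.
Proof. by apply/ffunP => x; rewrite !ffunE mulg1. Qed.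

Lemma shiftK z : cancel (shift z) (shift z^-1).
Proof. by move=> f; rewrite -shiftM mulVg shift1. Qed.

Lemma shiftD z f g : shift z (f + g) = shift z f + shift z g.
Proof. exact: linearD. Qed.
Lemma shiftB z f g : shift z (f - g) = shift z f - shift z g.
Proof. exact: linearB. Qed.
Lemma shiftZ z a f : shift z (a *: f) = a *: shift z f.
Proof. exact: linearZ. Qed.
Lemma shift_sum z (I : Type) (r : seq I) (P : pred I) (F : I -> fn) :
  shift z (\sum_(i <- r | P i) F i) = \sum_(i <- r | P i) shift z (F i).
Proof. exact: linear_sum. Qed.

Definition dot f g : R := \sum_x f x * g x.

Lemma dotC f g : dot f g = dot g f.
Proof. by apply: eq_bigr => x _; rewrite mulrC. Qed.

Fact dot_linear f : scalar (dot f).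
Proof.
move=> a g h; rewrite /dot mulr_sumr -big_split; apply: eq_bigr => x _.
by rewrite !ffunE /GRing.scale /=; ring.
Qed.
HB.instance Definition _ f :=
  GRing.isLinear.Build R fn R _ (dot f) (dot_linear f).

Lemma dotDr f g h : dot f (g + h) = dot f g + dot f h.
Proof. exact: linearD. Qed.
Lemma dotBr f g h : dot f (g - h) = dot f g - dot f h.
Proof. exact: linearB. Qed.
Lemma dotZr a f g : dot f (a *: g) = a * dot f g.
Proof. exact: linearZ. Qed.
Lemma dotDl f g h : dot (f + g) h = dot f h + dot g h.
Proof. by rewrite dotC dotDr !(dotC h). Qed.
Lemma dotBl f g h : dot (f - g) h = dot f h - dot g h.
Proof. by rewrite dotC dotBr !(dotC h). Qed.
Lemma dotZl a f g : dot (a *: f) g = a * dot f g.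
Proof. by rewrite dotC dotZr dotC. Qed.
Lemma dot_sumr f (I : Type) (r : seq I) (P : pred I) (F : I -> fn) :
  dot f (\sum_(i <- r | P i) F i) = \sum_(i <- r | P i) dot f (F i).
Proof. exact: linear_sum. Qed.

Definition dotE := (dotBr, dotDr, dotZr, dotBl, dotDl, dotZl).

Lemma dot_ge0 f : 0 <= dot f f.
Proof. by apply: sumr_ge0 => x _; rewrite -expr2 sqr_ge0. Qed.

Lemma le_sqr_dot f x : f x ^+ 2 <= dot f f.
Proof.
rewrite /dot (bigD1 x) //= -expr2 lerDl sumr_ge0 // => y _.
by rewrite -expr2 sqr_ge0.
Qed.

Lemma dot_eq0 f : dot f f = 0 -> f = 0.
Proof.
move=> f0; apply/ffunP => x; rewrite ffunE; apply/eqP; rewrite -sqrf_eq0.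
by rewrite eq_le sqr_ge0 andbT -f0 le_sqr_dot.
Qed.

Lemma dot_shift z f g : dot (shift z f) (shift z g) = dot f g.
Proof.
rewrite /dot [RHS](reindex_inj (mulIg z)).
by apply: eq_bigr => x _; rewrite !ffunE.
Qed.

Lemma dot_shiftl z f g : dot (shift z f) g = dot f (shift z^-1 g).
Proof. by rewrite -(dot_shift z^-1) shiftK. Qed.

Lemma dot_young f g (c : R) : 0 < c -> 2 * dot f g <= c * dot f f + dot g g / c.
Proof.
move=> c0; have := dot_ge0 (c *: f - g); rewrite !dotE (dotC g f) => ge0.
rewrite -(ler_pM2l c0) mulrDr [c * (_ / c)]mulrC divfK ?gt_eqF //; lra.
Qed.

Definition nrm f : R := Num.sqrt (dot f f).

Lemma sqr_nrm f : nrm f ^+ 2 = dot f f.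
Proof. by rewrite sqr_sqrtr ?dot_ge0. Qed.
Lemma nrm_ge0 f : 0 <= nrm f. Proof. exact: sqrtr_ge0. Qed.

Lemma cauchy_schwarz f g : dot f g <= nrm f * nrm g.
Proof.
apply: le_trans (ler_norm _) _.
rewrite -ler_sqr ?nnegrE ?mulr_ge0 ?nrm_ge0 ?normr_ge0 // exprMn !sqr_nrm.
rewrite real_normK ?num_real //.
have := dot_ge0 g; rewrite le_eqVlt => /predU1P[/esym/dot_eq0 g0|g0].
  by rewrite g0 -[0](scale0r f) !dotZr !mul0r expr0n /= mulr0.
have := dot_ge0 (dot g g *: f - dot f g *: g); rewrite !dotE (dotC g f).
rewrite [X in 0 <= X -> _]
  (_ : _ = dot g g * (dot f f * dot g g - dot f g ^+ 2)); last by ring.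
by rewrite pmulr_rge0 // subr_ge0.
Qed.

Lemma nrmD f g : nrm (f + g) <= nrm f + nrm g.
Proof.
rewrite -ler_sqr ?nnegrE ?addr_ge0 ?nrm_ge0 // sqrrD !sqr_nrm !dotE (dotC g f).
have := cauchy_schwarz f g; lra.
Qed.

Lemma nrmZ a f : nrm (a *: f) = `|a| * nrm f.
Proof. by rewrite /nrm !dotE mulrA -expr2 sqrtrM ?sqr_ge0 // sqrtr_sqr. Qed.

Lemma nrm_shift z f : nrm (shift z f) = nrm f.
Proof. by rewrite /nrm dot_shift. Qed.

Lemma nrm_sum (I : Type) (r : seq I) (P : pred I) (F : I -> fn) :
  nrm (\sum_(i <- r | P i) F i) <= \sum_(i <- r | P i) nrm (F i).
Proof.
elim/big_rec2: _ => [|i y f _ le]; first by rewrite -(scale0r 0) nrmZ normr0 mul0r.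
by apply: le_trans (nrmD _ _) _; rewrite lerD2l.
Qed.

Definition avg (A : {set gT}) f : fn := #|A|%:R^-1 *: \sum_(a in A) shift a f.

Fact avg_linear A : linear (avg A).
Proof.
move=> c f g; rewrite /avg.
under eq_bigr do rewrite linearP /=.
by rewrite big_split -scaler_sumr scalerDr !scalerA mulrC.
Qed.
HB.instance Definition _ A :=
  GRing.isLinear.Build R fn fn _ (avg A) (avg_linear A).

Lemma avgD A f g : avg A (f + g) = avg A f + avg A g.
Proof. exact: linearD. Qed.
Lemma avgB A f g : avg A (f - g) = avg A f - avg A g.
Proof. exact: linearB. Qed.
Lemma avgZ A a f : avg A (a *: f) = a *: avg A f.
Proof. exact: linearZ. Qed.

Definition fixed_by (A : {set gT}) f := forall a, a \in A -> shift a f = f.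

Lemma card_group_unit A : #|A|%:R != 0 :> R.
Proof. by rewrite pnatr_eq0 -lt0n cardG_gt0. Qed.

Lemma avg_fixed A : forall f, fixed_by A (avg A f).
Proof.
move=> f a aA; rewrite /avg shiftZ shift_sum; congr (_ *: _).
rewrite [RHS](reindex_inj (mulgI a)) /=.
by apply: eq_big => [b|b _]; rewrite ?groupMl // shiftM.
Qed.

Lemma avg_id A f : fixed_by A f -> avg A f = f.
Proof.
move=> fixf; rewrite /avg (eq_bigr (fun=> f)); last by move=> a /fixf.
by rewrite sumr_const -scaler_nat scalerA mulVf ?scale1r // card_group_unit.
Qed.

Lemma avgV A f : \sum_(a in A) shift a^-1 f = \sum_(a in A) shift a f.
Proof.
rewrite [RHS](reindex_inj invg_inj).
by apply: eq_bigl => a; rewrite groupV.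
Qed.

(** Averaging over a group is the orthogonal projection onto the functions
    that this group fixes: it is idempotent, and inversion in the group makes
    it self-adjoint. *)
Lemma dot_avg A f g : dot (avg A f) g = dot f (avg A g).
Proof.
rewrite /avg dotZl dotZr -(avgV A g) dotC !dot_sumr; congr (_ * _).
by apply: eq_bigr => a _; rewrite dotC dot_shiftl.
Qed.

Lemma fixed_byS A B f : A \subset B -> fixed_by B f -> fixed_by A f.
Proof. by move=> /subsetP AB fB a /AB /fB. Qed.

Lemma avg_avgl A B f : A \subset B -> avg A (avg B f) = avg B f.
Proof. by move=> AB; apply/avg_id/(fixed_byS AB)/avg_fixed. Qed.

Lemma dot_ext f g : (forall h, dot h f = dot h g) -> f = g.
Proof.
by move=> fg; apply/eqP; rewrite -subr_eq0; apply/eqP/dot_eq0; rewrite dotBr fg subrr.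
Qed.

Lemma avg_avgr A B f : A \subset B -> avg B (avg A f) = avg B f.
Proof.
by move=> AB; apply: dot_ext => h; rewrite -!dot_avg avg_avgl.
Qed.

Lemma avg1 f : avg 1%g f = f.
Proof. by apply: (avg_id (A := 1%G)) => a /set1gP ->; rewrite shift1. Qed.

(** Moving a translation across an average conjugates the group; in particular
    averages over normal subgroups commute with all translations. *)
Lemma avg_shift A s f : avg A (shift s f) = shift s (avg (A :^ s)%g f).
Proof.
rewrite /avg shiftZ shift_sum cardJg.
congr (_ *: _).
rewrite big_imset /=; last by move=> x y _ _; apply: conjg_inj.
by apply: eq_bigr => a _; rewrite -!shiftM conjgE !mulgA mulgV mul1g.
Qed.

(** Pythagoras for nested projections. Summed along an increasing chain of
    subgroups it splits the norm of a function into the contributions of the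
    layers. *)
Lemma dot_avgB A B f : A \subset B ->
  dot (avg A f - avg B f) (avg A f - avg B f) =
  dot (avg A f) (avg A f) - dot (avg B f) (avg B f).
Proof.
move=> AB; rewrite !(dotBr, dotBl).
have -> : dot (avg A f) (avg B f) = dot (avg B f) (avg B f).
  by rewrite !dot_avg avg_avgl // avg_avgl.
have -> : dot (avg B f) (avg A f) = dot (avg B f) (avg B f).
  by rewrite dotC !dot_avg avg_avgl // avg_avgl.
ring.
Qed.

Lemma nrm_subavg_le A f (c : R) :
  (forall a, a \in A -> nrm (f - shift a f) <= c) -> nrm (f - avg A f) <= c.
Proof.
move=> le_c.
have -> : f - avg A f = #|A|%:R^-1 *: \sum_(a in A) (f - shift a f).
  rewrite sumrB sumr_const scalerBr -scaler_nat scalerA mulVf ?scale1r //.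
  exact: card_group_unit.
rewrite nrmZ ger0_norm ?invr_ge0 ?ler0n //.
rewrite ler_pdivrMl ?ltr0n ?cardG_gt0 //.
apply: le_trans (nrm_sum _ _ _) _; apply: le_trans (ler_sum _ _) _.
  by move=> a /le_c; exact: id.
by rewrite sumr_const -[leLHS]mulr_natl.
Qed.

End GroupFunctions.

(** * Almost invariant functions *)

Section AlmostInvariance.
Variables (R : rcfType) (gT : finGroupType) (eps : R).
Hypothesis eps2 : eps ^+ 2 = 1.
Local Notation fn := {ffun gT -> R^o}.
Implicit Types (f g h u v w : fn) (x y z s t : gT) (A B C H : {group gT}).

(** The failure of [v] to be invariant under [s], up to the sign [eps]. The
    sign [1] measures how close the walk operator is to the identity and the
    sign [-1] how close it is to minus the identity; both are needed because
    the walk is not lazy. *)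
Definition defect s v : fn := v - eps *: shift s v.

Lemma defectV s v : defect s^-1 v = - (eps *: shift s^-1 (defect s v)).
Proof.
rewrite /defect shiftB shiftZ shiftK scalerBr scalerA -expr2 eps2 scale1r.
by rewrite opprB.
Qed.

Lemma dot_defectV s v :
  dot (defect s^-1 v) (defect s^-1 v) = dot (defect s v) (defect s v).
Proof.
rewrite defectV -scaleNr -shiftZ dot_shift !(dotZl, dotZr) mulrA -expr2.
by rewrite sqrrN eps2 mul1r.
Qed.

(** If [s] moves [A] enough for [A] and its conjugate to generate [B], then a
    function fixed by both [A] and that conjugate is fixed by [B]. Hence the
    translate by [s] of an [A]-fixed function with no [B]-fixed part has no
    [A]-fixed part. *)
Lemma avg_shift_eq0 A B s u : abelian B -> A \subset B -> (A :^ s \subset B)%g ->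
  (B \subset A * A :^ s)%g -> fixed_by A u -> avg B u = 0 -> avg A (shift s u) = 0.
Proof.
move=> /centsP cBB sAB sAsB /subsetP sBAAs fixu Bu0.
rewrite avg_shift; suff -> : avg (A :^ s)%g u = 0 by rewrite linear0.
rewrite -Bu0 -(avg_avgr _ sAsB) [RHS]avg_id // => b.
move=> /sBAAs/mulsgP[a c aA cAs ->]; rewrite shiftM (@avg_fixed _ _ (A :^ s)%G) //.
rewrite /avg shiftZ shift_sum.
congr (_ *: _); apply: eq_bigr => d dAs.
by rewrite -shiftM (cBB a (subsetP sAB a aA) d (subsetP sAsB d dAs)) shiftM fixu.
Qed.

(** For a chain of subgroups [C], [A], [B], call a layer the part of a
    function that a group fixes and the next one kills. The two translates of
    the top layer [u] by [s] and its inverse both lie in the layer just below,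
    and they are orthogonal, because [s ^+ 2] also moves [A] enough. If [v] is
    almost invariant under [s], its lower layer has to contain almost all of
    both translates, that is, about twice the mass of [u]. This gain of a
    factor smaller than 1 from layer to layer is what keeps the spectral gap
    independent of the length of the chain. *)
Lemma chain_step A B C s v :
    abelian B -> A \subset B -> C \subset A -> (C \subset 'C[s])%g ->
    (forall r, r \in [:: s; s^-1; s ^+ 2]%g ->
       (A :^ r \subset B)%g /\ (B \subset A * A :^ r)%g) ->
  forall u w, u = avg A v - avg B v -> w = avg C v - avg A v ->
  dot u u <= 2 / 3 * dot w w + 16 / 3 * dot (defect s v) (defect s v).
Proof.
move=> cBB sAB sCA cCs gen u w def_u def_w.
have fixu : fixed_by A u.
  move=> a aA; rewrite def_u shiftB (@avg_fixed _ _ A) //.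
  by rewrite (@avg_fixed _ _ B) // (subsetP sAB).
have Bu0 : avg B u = 0 by rewrite def_u avgB avg_avgr // avg_avgl // subrr.
have avg0 r : r \in [:: s; s^-1; s ^+ 2]%g -> avg A (shift r u) = 0.
  by case/gen=> ArB BAr; apply: avg_shift_eq0 Bu0.
have Cfix r : (r \in 'C(C))%g -> avg C (shift r u) = shift r u.
  move=> rC; rewrite avg_id // => c cC.
  rewrite -shiftM -(centP rC c cC) shiftM fixu //; exact: subsetP sCA c cC.
have sC : (s \in 'C(C))%g by rewrite -sub1set centsC cent_set1.
have dotw r : (r \in 'C(C))%g -> r \in [:: s; s^-1; s ^+ 2]%g ->
    dot v (shift r u) = dot w (shift r u).
  by move=> rC rs; rewrite def_w dotBl !dot_avg Cfix // avg0 // linear0 subr0.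
have dotvu : dot v u = dot u u.
  by rewrite def_u dot_avgB // dotBr !dot_avg !avg_avgl.
set w1 := shift s u; set w2 := shift s^-1 u.
have w12 : dot w1 w2 = 0.
  rewrite dotC /w2 dot_shiftl invgK -shiftM -{1}(avg_id fixu) dot_avg.
  by rewrite avg0 ?linear0 // !inE eqxx !orbT.
(* The pairing of [v] with [u] is compared with its pairings with the two
   translates of [u], which only see the lower layer [w]. *)
have E : 2 * dot u u = eps * dot w (w1 + w2) +
    (dot (defect s v) u + dot (defect s^-1 v) u).
  rewrite dotDr -!dotw ?groupV ?inE ?eqxx ?orbT // /w1 /w2 /defect !dotBl !dotZl.
  rewrite !dot_shiftl invgK dotvu; ring.
(* The weights 1 and 4 are chosen to leave the coefficient 2 / 3 < 1. *)
have Y1 := dot_young w (eps *: (w1 + w2)) ltr01.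
have four0 : 0 < 4 :> R by [].
have Y2 := dot_young (defect s v) u four0.
have Y3 := dot_young (defect s^-1 v) u four0.
have ww : dot (eps *: (w1 + w2)) (eps *: (w1 + w2)) = 2 * dot u u.
  rewrite dotZl dotZr mulrA -expr2 eps2 mul1r dotDl !dotDr (dotC w2 w1) w12.
  by rewrite !dot_shift; ring.
move: Y1 Y2 Y3; rewrite dot_defectV ww dotZr; lra.
Qed.

Lemma norm_sign : `|eps| = 1.
Proof. by apply/eqP; rewrite -(@pexpr_eq1 _ _ 2) // -normrX eps2 normr1. Qed.

Lemma nrm_defect_exp s v a :
  nrm (v - eps ^+ a *: shift (s ^+ a)%g v) <= a%:R * nrm (defect s v).
Proof.
elim: a => [|a IH].
  by rewrite expr0 expg0 shift1 scale1r subrr mul0r -(scale0r 0) nrmZ normr0 mul0r.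
have -> : v - eps ^+ a.+1 *: shift (s ^+ a.+1)%g v =
    defect s v + eps *: shift s (v - eps ^+ a *: shift (s ^+ a)%g v).
  rewrite shiftB shiftZ -shiftM -expgS scalerBr scalerA -exprS /defect.
  by rewrite addrA subrK.
apply: le_trans (nrmD _ _) _; rewrite nrmZ norm_sign mul1r nrm_shift -natr1 mulrDl mul1r.
by rewrite addrC lerD2r.
Qed.

(** A commutator contains each letter together with its inverse, so the signs
    [eps] cancel and an almost [eps]-invariant function is almost invariant
    under commutators in the usual sense, for either sign. *)
Lemma nrm_sub_commutator s t z a b v :
    (s ^+ a * t ^+ b = t ^+ b * s ^+ a * z)%g ->
  nrm (v - shift z v) <= 2 * (a%:R * nrm (defect s v) + b%:R * nrm (defect t v)).
Proof.
move=> com; set d := (X in _ <= 2 * X).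
have le1 x y (c e : nat) (f := v - eps ^+ c *: shift x v) (g := v - eps ^+ e *: shift y v) :
    nrm (v - eps ^+ (c + e) *: shift (x * y)%g v) <= nrm f + nrm g.
  have -> : v - eps ^+ (c + e) *: shift (x * y)%g v = f + eps ^+ c *: shift x g.
    rewrite shiftM exprD -scalerA shiftB shiftZ scalerBr.
    by rewrite addrA subrK.
  by apply: le_trans (nrmD _ _) _; rewrite nrmZ normrX norm_sign expr1n mul1r nrm_shift.
have st : nrm (v - eps ^+ (a + b) *: shift (s ^+ a * t ^+ b)%g v) <= d.
  by apply: le_trans (le1 _ _ _ _) _; rewrite lerD ?nrm_defect_exp.
have ts : nrm (v - eps ^+ (a + b) *: shift (t ^+ b * s ^+ a)%g v) <= d.
  rewrite addnC; apply: le_trans (le1 _ _ _ _) _.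
  by rewrite addrC lerD ?nrm_defect_exp.
have -> : nrm (v - shift z v) = nrm (eps ^+ (a + b) *:
    (shift (t ^+ b * s ^+ a)%g v - shift (s ^+ a * t ^+ b)%g v)).
  by rewrite com (shiftM _ z) -shiftB nrmZ nrm_shift normrX norm_sign expr1n mul1r.
rewrite mulr_natl mulr2n scalerBr.
rewrite [X in nrm X](_ : _ = (v - eps ^+ (a + b) *: shift (s ^+ a * t ^+ b)%g v) + (-1) *:
   (v - eps ^+ (a + b) *: shift (t ^+ b * s ^+ a)%g v)).
  by apply: le_trans (nrmD _ _) _; rewrite nrmZ normrN1 mul1r lerD.
by rewrite scaleN1r opprB [RHS]addrC addrA subrK.
Qed.

(** In a Heisenberg group of order p ^ 3 every central element is a product of
    two commutators of powers with exponents at most [d], as soon as p <= d ^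
    2. The cost is thus of the order of the square root of p; writing a
    central element as a power of the generator would cost p. *)
Lemma nrm_sub_avg_center H s t d v : (0 < d)%N ->
    (forall z, z \in H -> exists a b c z1 z2,
      [/\ (a <= d)%N, (b <= d)%N, (c <= d)%N &
      [/\ z = z1 * z2, s ^+ a * t ^+ b = t ^+ b * s ^+ a * z1 &
        s ^+ c * t = t * s ^+ c * z2]]%g) ->
  nrm (v - avg H v) <= 4 * d%:R * (nrm (defect s v) + nrm (defect t v)).
Proof.
move=> d0 fac; apply: nrm_subavg_le => z /fac[a][b][c][z1][z2][ad bd cd [-> E1 E2]].
have := nrm_sub_commutator v E1; have := @nrm_sub_commutator s t z2 c 1 v E2.
have -> : v - shift (z1 * z2)%g v = (v - shift z1 v) + shift z1 (v - shift z2 v).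
  by rewrite shiftB -shiftM addrA subrK.
move=> le2 le1; apply: le_trans (nrmD _ _) _; rewrite nrm_shift.
apply: le_trans (lerD le1 le2) _.
have D0 := nrm_ge0 (defect s v); have D1 := nrm_ge0 (defect t v).
have le3 (k : nat) (q : R) : 0 <= q -> (k <= d)%N -> k%:R * q <= d%:R * q.
  by move=> q0 kd; rewrite ler_wpM2r // ler_nat.
have := le3 _ _ D0 ad; have := le3 _ _ D1 bd; have := le3 _ _ D0 cd.
have := le3 _ _ D1 d0; lra.
Qed.

End AlmostInvariance.

(** * Unitriangular matrices: elementary matrices and row groups *)

(** The identity when [j <= i]. The definition is locked so that unification
    never compares elementary matrices entry by entry. *)
HB.lock Definition elem (p n : nat) (i j : 'I_n) (a : 'F_p) : unitri p n :=
  insubd (unitri_one p n) (1%:M + a *: delta_mx i j).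

Arguments elem {p n} i j a.

Section Unitriangular.
Variables p n : nat.
Implicit Types (x y z g : unitri p n) (i j k l u v : 'I_n) (a b c e : 'F_p).

Lemma unitri_entry x u v : (v <= u)%N -> x u v = (u == v)%:R.
Proof. by move/unitriangularP: (unitri_valP x) => /[apply]. Qed.

Lemma unitri_eq x y : (forall u v, (u < v)%N -> x u v = y u v) -> x = y.
Proof.
move=> xy; apply/val_inj/matrixP => u v /=.
by case: (ltnP u v) => [/xy|vu] //; rewrite !unitri_entry.
Qed.

Lemma mulmx_delta (M : 'M['F_p]_n) k l u v :
  (M *m delta_mx k l) u v = M u k * (v == l)%:R.
Proof.
rewrite mxE (bigD1 k) //= big1 ?addr0 => [|w /negPf wk]; rewrite mxE ?eqxx //.
by rewrite wk mulr0.
Qed.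

Lemma delta_mulmx (M : 'M['F_p]_n) k l u v :
  (delta_mx k l *m M) u v = (u == k)%:R * M l v.
Proof.
rewrite mxE (bigD1 l) //= big1 ?addr0 => [|w /negPf wl]; rewrite mxE ?eqxx ?andbT //.
by rewrite wl andbF mul0r.
Qed.

Lemma val_elem i j a : (i < j)%N -> elem i j a = 1%:M + a *: delta_mx i j :> 'M_n.
Proof.
move=> ij; rewrite elem.unlock (insubdK (unitri_one p n)) //.
apply/unitriangularP => u v vu; rewrite !mxE.
have -> : (u == i) && (v == j) = false.
  by apply: contraTF vu => /andP[/eqP -> /eqP ->]; rewrite -ltnNge.
by rewrite mulr0 addr0.
Qed.

Lemma elemE i j a u v : (i < j)%N ->
  elem i j a u v = (u == v)%:R + a * ((u == i) && (v == j))%:R.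
Proof. by move=> ij; rewrite val_elem // !mxE. Qed.

Lemma elem0 i j : (i < j)%N -> elem (p := p) i j 0 = 1%g.
Proof. by move=> ij; apply: unitri_eq => u v uv; rewrite elemE // mul0r addr0 mxE. Qed.

Lemma elemD i j a b : (i < j)%N -> elem i j (a + b) = (elem i j a * elem i j b)%g.
Proof.
move=> ij; apply/val_inj; rewrite /= !val_elem // mulmxDr !mulmxDl !mulmx1 mul1mx.
rewrite -scalemxAr -scalemxAl mul_delta_mx_0 ?scaler0 ?addr0; last first.
  by rewrite -val_eqE gtn_eqF.
by rewrite scalerDl addrA.
Qed.

Lemma elemV i j a : (i < j)%N -> elem i j (- a) = (elem i j a)^-1%g.
Proof.
by move=> ij; apply/eqP; rewrite eq_sym eq_invg_mul -elemD // subrr elem0.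
Qed.

Lemma elemX i j a (c : nat) : (i < j)%N -> (elem i j a ^+ c)%g = elem i j (a *+ c).
Proof.
move=> ij; elim: c => [|c IH]; first by rewrite mulr0n elem0.
by rewrite expgS IH mulrS elemD.
Qed.

(** The matrices that vanish above the diagonal outside of the positions [P].
    All the subgroups used below are of this form. *)
Definition pattern (P : rel 'I_n) : {set unitri p n} :=
  [set x | [forall u : 'I_n, forall v : 'I_n, (u < v)%N && ~~ P u v ==> (unitri_val x u v == 0)]].

Lemma patternP (P : rel 'I_n) x :
  reflect (forall u v, (u < v)%N -> ~~ P u v -> x u v = 0) (x \in pattern P).
Proof.
rewrite inE; apply: (iffP forallP) => [H u v uv nP | H u].
  by apply/eqP; move/forallP/(_ v)/implyP: (H u) => ->; rewrite ?uv.
by apply/forallP => v; apply/implyP => /andP[uv nP]; apply/eqP/H.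
Qed.

Lemma patternS (P Q : rel 'I_n) : subrel P Q -> pattern P \subset pattern Q.
Proof.
move=> PQ; apply/subsetP => x /patternP xP; apply/patternP => u v uv nQ.
by apply: xP => //; apply: contra nQ => /PQ.
Qed.

(** An entry of a product at a position outside of [P] could only come from a
    composite of two positions of [P]. *)
Lemma pattern_group_set (P : rel 'I_n) :
    (forall u v w, P u v -> P v w -> P u w) -> group_set (pattern P).
Proof.
move=> trP; apply/group_setP; split=> [|x y /patternP xP /patternP yP].
  by apply/patternP => u v uv _; rewrite mxE -val_eqE ltn_eqF.
apply/patternP => u v uv nP; rewrite mxE big1 // => w _.
case: (ltngtP u w) => [uw|wu|/val_inj <-]; last 2 first.
- by rewrite unitri_entry 1?ltnW // -val_eqE gtn_eqF // mul0r.
- by rewrite (yP _ _ uv nP) mulr0.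
case: (ltngtP w v) => [wv|vw|/val_inj ->]; last 2 first.
- by rewrite [y _ _]unitri_entry 1?ltnW // -val_eqE gtn_eqF // mulr0.
- by rewrite (xP _ _ uv nP) mul0r.
case Puw : (P u w); last by rewrite xP ?Puw // mul0r.
case Pwv : (P w v); last by rewrite yP ?Pwv // mulr0.
by case/negP: nP; apply: trP Pwv.
Qed.

(** Columns [i + lo] to [hi] of row [i]. In [row_group] the offset is [lo.+1],
    so that [lo = 0] gives a whole row above the diagonal and [lo = 1] its
    part inside of the commutator subgroup. *)
Definition row_pat i (lo hi : nat) : rel 'I_n :=
  [rel u v | (u == i) && (i + lo <= v <= hi)%N].

Fact row_group_set i lo hi : group_set (pattern (row_pat i lo.+1 hi)).
Proof.
apply: pattern_group_set => u v w /= /andP[/eqP -> lv] /andP[/eqP vi lw].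
by move: lv; rewrite vi addnS -ltn_subRL subnn.
Qed.
Canonical row_group i lo hi := Group (row_group_set i lo hi).

Lemma row_off i lo hi x u v : x \in row_group i lo hi -> u != i ->
  x u v = (u == v)%:R.
Proof.
move=> /patternP xR ui; case: (ltnP u v) => [uv|]; last exact: unitri_entry.
by rewrite -[u == v]val_eqE ltn_eqF //= xR //= negb_and ui.
Qed.

Lemma row_out i lo hi x v : x \in row_group i lo hi -> (i < v)%N ->
  ~~ (i + lo.+1 <= v <= hi)%N -> x i v = 0.
Proof. by move=> /patternP xR iv out; apply: xR => //; rewrite /row_pat /= eqxx. Qed.

Lemma row_eq i lo hi x y : x \in row_group i lo hi -> y \in row_group i lo hi ->
  (forall v, (i < v)%N -> x i v = y i v) -> x = y.
Proof.
move=> xR yR xy; apply: unitri_eq => u v uv.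
have [ui|ui] := eqVneq u i; first by rewrite ui xy // -ui.
by rewrite (row_off v xR ui) (row_off v yR ui).
Qed.

Lemma rowM i lo hi x y v : y \in row_group i lo hi -> (i < v)%N ->
  (x * y)%g i v = x i v + y i v.
Proof.
move=> yR iv; rewrite mxE (bigD1 i) //= unitri_entry // eqxx mul1r addrC.
rewrite (bigD1 v) /=; last by rewrite -val_eqE gtn_eqF.
rewrite (row_off _ yR); last by rewrite -val_eqE gtn_eqF.
rewrite eqxx mulr1 big1 ?addr0 // => w /andP[wi /negPf wv].
by rewrite (row_off _ yR wi) wv mulr0.
Qed.

Lemma row_abelian i lo hi : abelian (row_group i lo hi).
Proof.
apply/centsP => x xR y yR; apply: (row_eq (groupM xR yR) (groupM yR xR)) => v iv.
by rewrite (rowM _ yR iv) (rowM _ xR iv) addrC.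
Qed.

Lemma row_groupS i lo hi lo' hi' : (lo' <= lo)%N -> (hi <= hi')%N ->
  row_group i lo hi \subset row_group i lo' hi'.
Proof.
move=> le_lo le_hi; apply: patternS => u v /= /andP[ui /andP[lov vhi]].
by rewrite /row_pat /= ui /=; apply/andP; split; lia.
Qed.

Lemma elem_row i lo hi j a : (i + lo.+1 <= j <= hi)%N -> elem i j a \in row_group i lo hi.
Proof.
move=> /andP[loj jhi]; apply/patternP => u v uv.
have ij : (i < j)%N by lia.
rewrite elemE // [u == v]negbTE ?add0r; last by rewrite -val_eqE ltn_eqF.
case E: ((u == i) && (v == j)); last by rewrite mulr0.
by move/andP: E => [/eqP -> /eqP ->]; rewrite /row_pat /= eqxx loj jhi.
Qed.

(** The row group of [i] is a group of row vectors, and an elementary matrix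
    with larger indices acts on it by a column operation. *)
Lemma row_conj i lo hi x k l e : x \in row_group i lo hi -> (i < k)%N -> (k < l)%N ->
  (x ^ elem k l e = x * elem i l (e * x i k)%R)%g.
Proof.
move=> xR ik kl; have il := ltn_trans ik kl.
have li : l != i by rewrite -val_eqE gtn_eqF.
have ki : k != i by rewrite -val_eqE gtn_eqF.
rewrite conjgE; apply: (canLR (mulKg _)); apply/val_inj => /=.
rewrite !val_elem // !mulmxDl !mulmxDr !mul1mx !mulmx1.
rewrite -!scalemxAl -!scalemxAr.
apply/matrixP => u v.
have addE (M N : 'M['F_p]_n) : (M + N) u v = M u v + N u v by rewrite mxE.
have scaleE c (M : 'M['F_p]_n) : (c *: M) u v = c * M u v by rewrite mxE.
rewrite !(addE, scaleE).
rewrite !mulmx_delta !delta_mulmx mulmx_delta.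
rewrite (row_off v xR li) (row_off i xR li) (negPf li) mul0r !mulr0 addr0.
have -> : x u i = (u == i)%:R.
  case: (ltnP u i) => [ui|]; last exact: unitri_entry.
  by rewrite (row_off i xR) // -val_eqE ltn_eqF.
have [->|ui] := eqVneq u i.
  by rewrite [i == k]eq_sym (negPf ki) mul0r mulr0 addr0 mul1r mulrA.
by rewrite (row_off k xR ui) mul0r mulr0 addr0 [l == v]eq_sym.
Qed.

End Unitriangular.

(** * Energy estimates inside one row *)

Lemma sub_mul_conjg (gT : finGroupType) (A : {group gT}) (B : {set gT}) r :
    (forall x, x \in B -> exists2 y, y \in A & x * (y ^ r)^-1 \in A)%g ->
  (B \subset A * A :^ r)%g.
Proof.
move=> fac; apply/subsetP => x /fac[y yA xyA].
apply/mulsgP; exists (x * (y ^ r)^-1)%g (y ^ r)%g => //; last by rewrite mulgKV.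
by rewrite memJ_conjg.
Qed.

Section RowEnergy.
Variables (R : rcfType) (p n : nat) (eps : R).
Hypotheses (p_pr : prime p) (eps2 : eps ^+ 2 = 1).
Implicit Types (i j k l : 'I_n) (v : {ffun unitri p n -> R^o}).

Lemma elem_comm i j k (a b : nat) : (i < j)%N -> (j < k)%N ->
  (elem (p := p) i j 1%R ^+ a * elem j k 1%R ^+ b =
   elem j k 1%R ^+ b * elem i j 1%R ^+ a * elem i k (b * a)%N%:R)%g.
Proof.
move=> ij jk; rewrite !elemX // -mulgA; apply: (canRL (mulKVg _)).
have eR : elem (p := p) i j (1 *+ a) \in row_group p i 0 j by apply: elem_row; lia.
rewrite -conjgE (row_conj _ eR ij jk); congr (_ * elem i k _)%g.
by rewrite elemE // !eqxx -[i == j]val_eqE ltn_eqF // add0r mulr1 -natrM.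
Qed.

(** The first layer: [elem i j 1] and [elem j k 1] generate a Heisenberg group
    whose center is the row group of columns [k] only. *)
Lemma row_start i j k v (d : nat) : j = i.+1 :> nat -> k = j.+1 :> nat -> (p <= d ^ 2)%N ->
  nrm (v - avg (row_group p i 1 k) v) <=
  4 * d%:R * (nrm (defect eps (elem i j 1) v) + nrm (defect eps (elem j k 1) v)).
Proof.
move=> ij jk pd; have lij : (i < j)%N by lia.
have ljk : (j < k)%N by lia.
have lik : (i < k)%N by lia.
have d0 : (0 < d)%N by rewrite lt0n; apply: contraTneq pd => ->; rewrite -ltnNge prime_gt0.
apply: nrm_sub_avg_center => // z zR.
pose m := nat_of_ord (z i k); have mp : (m < p)%N.
  by have := ltn_ord (z i k); rewrite [X in (_ < X)%N]Fp_cast.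
(* Euclidean division of the entry by [d]: the quotient part is a commutator
   of a power [d], the remainder one with a single [elem j k 1]. *)
exists d, (m %/ d)%N, (m %% d)%N, (elem i k (m %/ d * d)%:R), (elem i k (m %% d)%:R).
split=> //.
- rewrite -ltnS ltn_divLR // mulSn; apply: leq_trans mp (leq_trans pd _).
  by rewrite -mulnn; lia.
- by rewrite ltnW // ltn_mod.
split; last first.
- by have := elem_comm (m %% d) 1 lij ljk; rewrite !expg1 mul1n.
- exact: elem_comm.
have eR (c : 'F_p) : elem i k c \in row_group p i 1 k by apply: elem_row; lia.
rewrite -elemD // -natrD -divn_eq natr_Zp.
apply: (row_eq zR (eR _)) => w iw; rewrite elemE // -[i == w]val_eqE ltn_eqF // add0r eqxx /=.
have [->|wk] := eqVneq w k; first by rewrite mulr1.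
rewrite mulr0 (row_out zR) //; move: wk; rewrite -val_eqE /=; lia.
Qed.

Hypothesis p_odd : odd p.

Lemma Fp2_neq0 : (1 *+ 2 : 'F_p) != 0.
Proof.
rewrite -(dvdn_pcharf (pchar_Fp p_pr)) gtnNdvd //.
by rewrite ltn_neqAle prime_gt1 // andbT; apply: contraTneq p_odd => <-.
Qed.

(** Conjugation by [elem k l e] adds [e] times column [k] to column [l]; as
    [e] is invertible, the conjugate row group supplies the missing column
    [l]. *)
Lemma row_conj_gen i k l (e : 'F_p) : (i.+1 < k)%N -> l = k.+1 :> nat -> e != 0 ->
  ((row_group p i 1 k :^ elem k l e \subset row_group p i 1 l) /\
   (row_group p i 1 l \subset row_group p i 1 k * row_group p i 1 k :^ elem k l e))%g.
Proof.
move=> ik lk e0; have kl : (k < l)%N by rewrite lk.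
have ik' := ltnW ik; have il := ltn_trans ik' kl.
have sub : row_group p i 1 k \subset row_group p i 1 l by apply: row_groupS => //; lia.
split.
  apply/subsetP => _ /imsetP[x xR ->]; rewrite (row_conj _ xR) //.
  by apply: groupM; [exact: (subsetP sub) | apply: elem_row; lia].
apply: sub_mul_conjg => x xR.
have ekR : elem i k (x i l / e) \in row_group p i 1 k by apply: elem_row; lia.
have elR : elem i l (x i l) \in row_group p i 1 l by apply: elem_row; lia.
exists (elem i k (x i l / e)); first exact: ekR.
have : (elem i k (x i l / e)%R ^ elem k l e = elem i k (x i l / e)%R * elem i l (x i l))%g.
  rewrite (row_conj e ekR ik' kl); congr (_ * elem i l _)%g.
  by rewrite elemE // !eqxx -[i == k]val_eqE ltn_eqF // mulr1 add0r mulrC divfK.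
move: (elem i k (x i l / e)%R ^ elem k l e)%g => y yE.
have yR : y \in row_group p i 1 l.
  by rewrite yE; apply: groupM elR; apply: (subsetP sub).
have xyR : (x * y^-1)%g \in row_group p i 1 l by apply: groupM; rewrite ?groupV.
apply/patternP => u w uw nP.
have [/andP[/eqP ui /eqP wl]|nuw] := boolP ((u == i) && (w == l)).
  have yil : y i l = x i l.
    rewrite yE (rowM _ elR il).
    have -> : elem i k (x i l / e) i l = 0 by apply: row_out ekR il _; rewrite lk; lia.
    by rewrite add0r elemE // !eqxx -[i == l]val_eqE ltn_eqF // mulr1 add0r.
  have := rowM (x * y^-1)%g yR il; rewrite mulgKV yil ui wl.
  by move/esym/(canRL (addrK _)) => ->; rewrite subrr.
move/patternP: xyR; apply=> //; apply: contra nP => /andP[ui /andP[w1 w2]].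
rewrite /row_pat /= ui w1 /=; move: nuw; rewrite ui /= -val_eqE /=; lia.
Qed.

Lemma row_cent i k l (e : 'F_p) : (i < k)%N -> (k < l)%N ->
  (row_group p i 1 k.-1 \subset 'C[elem k l e])%g.
Proof.
move=> ik kl; rewrite sub_cent1; apply/centP => x xR; apply/esym/commgP/conjg_fixP.
rewrite (row_conj _ xR ik kl) (row_out xR ik); last by lia.
by rewrite mulr0 elem0 ?mulg1 // (ltn_trans ik).
Qed.

(** The squared generator is [elem k l 2], to which [row_conj_gen] applies
    because [p] is odd. *)
Lemma row_step i k l v : (i.+1 < k)%N -> l = k.+1 :> nat ->
  forall u w, u = avg (row_group p i 1 k) v - avg (row_group p i 1 l) v ->
    w = avg (row_group p i 1 k.-1) v - avg (row_group p i 1 k) v ->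
  dot u u <= 2 / 3 * dot w w +
    16 / 3 * dot (defect eps (elem k l 1) v) (defect eps (elem k l 1) v).
Proof.
move=> ik lk; have kl : (k < l)%N by rewrite lk.
apply: chain_step => //.
- exact: row_abelian.
- by apply: row_groupS => //; lia.
- by apply: row_groupS => //; lia.
- by apply: row_cent => //; lia.
move=> r; rewrite !inE => /or3P[] /eqP ->.
- by apply: row_conj_gen => //; apply: oner_neq0.
- by rewrite -elemV //; apply: row_conj_gen => //; rewrite oppr_eq0 oner_neq0.
- by rewrite elemX //; apply: row_conj_gen => //; apply: Fp2_neq0.
Qed.

End RowEnergy.

(** * The filtration of the commutator subgroup by rows *)

Section DerivedRows.
Variables p m : nat.
Implicit Types (x y z g : unitri p m.+1) (u v : 'I_m.+1) (i j k : nat).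

(** Positions in the first [i] rows that are not on the superdiagonal. As [i]
    grows, these groups form a chain of normal subgroups ending with the
    commutator subgroup, reached at [i = m.-1]. *)
Definition derived_pat i : rel 'I_m.+1 := [rel u v : 'I_m.+1 | (u < i)%N && (u.+1 < v)%N].

Fact derived_rows_group_set i : group_set (pattern p (derived_pat i)).
Proof.
apply: pattern_group_set => u v w /andP[ui uv] /andP[_ vw].
by rewrite /derived_pat /= ui; lia.
Qed.
Canonical derived_rows i := Group (derived_rows_group_set i).

(** The pattern is closed under moving up and to the right, which is what
    multiplication by triangular matrices on both sides does to the part of a
    matrix above the diagonal. *)
Lemma derived_rows_norm i g : (g \in 'N(derived_rows i))%g.
Proof.
rewrite inE; apply/subsetP => _ /imsetP[x /patternP xN ->].
apply/patternP => u v uv nP.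
have -> : unitri_val (x ^ g)%g = unitri_val g^-1%g *m ((x : 'M_m.+1) - 1%:M) *m g + 1%:M.
  rewrite mulmxBr mulmx1 mulmxBl unitri_VE mulVmx.
    by rewrite subrK conjgE !unitri_ME unitri_VE mulmxA.
  exact/unitriangular_unitmx/unitri_valP.
rewrite mxE [X in _ + X]mxE [u == v]negbTE ?addr0; last by rewrite -val_eqE ltn_eqF.
rewrite mxE big1 // => l _; rewrite mxE mulr_suml big1 // => k _.
have [uk|ku] := leqP u k; last first.
  by rewrite (unitri_entry _ (ltnW ku)) -[u == k]val_eqE gtn_eqF // !mul0r.
have [lv|vl] := leqP l v; last first.
  by rewrite (unitri_entry _ (ltnW vl)) -[l == v]val_eqE gtn_eqF // mulr0.
have -> : ((x : 'M_m.+1) - 1%:M) k l = 0; last by rewrite mulr0 mul0r.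
have -> : ((x : 'M_m.+1) - 1%:M) k l = x k l - (k == l)%:R by rewrite !mxE.
have [kl|lk] := ltnP k l; last by rewrite unitri_entry ?subrr.
rewrite xN // -?[k == l]val_eqE ?ltn_eqF ?subr0 //.
by apply: contra nP; rewrite /derived_pat /= => /andP[ki kl2]; apply/andP; split; lia.
Qed.

Lemma derived_rowsS i j : (i <= j)%N -> derived_rows i \subset derived_rows j.
Proof.
move=> ij; apply: patternS => u v /andP[ui uv].
by rewrite /derived_pat /= uv andbT (leq_trans ui).
Qed.

Lemma row_group_derived (I : 'I_m.+1) j : (I < j)%N -> row_group p I 1 m \subset derived_rows j.
Proof.
move=> ij; apply: patternS => u v /andP[/eqP -> /andP[uv _]].
by rewrite /derived_pat /= ij; move: uv; rewrite addn2.
Qed.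

(** A matrix of the larger group is one of the smaller group times its own row
    [I]. *)
Lemma fixed_by_derived_rowsS (R : rcfType) (I : 'I_m.+1) (f : {ffun unitri p m.+1 -> R^o}) :
  fixed_by (derived_rows I) f -> fixed_by (row_group p I 1 m) f ->
  fixed_by (derived_rows I.+1) f.
Proof.
move=> fixN fixR x xN.
pose r0 : 'M['F_p]_m.+1 := \matrix_(u, v) if u == I then x u v else (u == v)%:R.
have r0U : unitriangular r0.
  by apply/unitriangularP => u v vu; rewrite mxE unitri_entry // if_same.
have [r rE] : exists r : unitri p m.+1, forall u v,
    r u v = if u == I then x u v else (u == v)%:R.
  by exists (Unitri r0U) => u v; rewrite [LHS]mxE.
have rR : r \in row_group p I 1 m.
  apply/patternP => u v uv; rewrite /row_pat /= rE.
  case: (eqVneq u I) uv => [-> Iv|_ uv _]; last by rewrite -val_eqE ltn_eqF.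
  rewrite leq_ord andbT addn2 => nI2; move/patternP: xN; apply=> //.
  by rewrite /derived_pat /= ltnSn.
have rN : r \in derived_rows I.+1 by apply: subsetP (row_group_derived _) _ rR.
rewrite -(mulgKV r x) shiftM (fixR r rR); apply: fixN.
have yN : (x * r^-1)%g \in derived_rows I.+1 by rewrite groupM ?groupV.
apply/patternP => u v uv nP.
have [uI|uI] := eqVneq u I; last first.
  move/patternP: yN; apply=> //; apply: contra nP => /andP[ui iv].
  by rewrite /derived_pat /= in ui iv *; rewrite iv andbT; move: ui uI; rewrite -val_eqE /=; lia.
move: uv; rewrite uI => Iv; have := rowM (x * r^-1)%g rR Iv.
by rewrite mulgKV rE eqxx => /esym/(canRL (addrK _)) => ->; rewrite subrr.
Qed.

End DerivedRows.

(** * Spectral gap off the abelianization *)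

(** The bound for the sum does not involve the number of terms; the quantity
    controlled in the induction is the partial sum plus twice the last term. *)
Lemma sum_geometric_recursion (R : realFieldType) (D E : nat -> R) (a b : nat) :
    (forall k, 0 <= D k) ->
    (forall k, (a < k)%N -> (k < b)%N -> D k <= 2 / 3 * D k.-1 + 16 / 3 * E k) ->
    (a < b)%N ->
  \sum_(a <= k < b) D k <= 3 * D a + 16 * \sum_(a.+1 <= k < b) E k.
Proof.
move=> D0 rec ab; suff : \sum_(a <= k < b) D k + 2 * D b.-1 <=
    3 * D a + 16 * \sum_(a.+1 <= k < b) E k by have := D0 b.-1; lra.
elim: b ab rec => // b IH; rewrite ltnS leq_eqVlt => /predU1P[<- _|ab rec].
  by rewrite big_nat1 big_geq //=; lra.
have {}IH := IH ab (fun k ak kb => rec k ak (ltnW kb)).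
rewrite !big_nat_recr //=; last exact: ltnW.
have := rec b ab (ltnSn b); lra.
Qed.

Lemma ceil_sqrt (p : nat) : exists2 d, (p <= d ^ 2)%N & (d ^ 2 <= 4 * p)%N.
Proof.
have ex : exists d, (p <= d ^ 2)%N by exists p; rewrite -mulnn; case: p => // q; nia.
case: (ex_minnP ex) => d pd min; exists d => //.
case: d pd min => // d pd min.
have : (d ^ 2 < p)%N by rewrite ltnNge; apply/negP => /min; rewrite ltnn.
move: pd; rewrite -!mulnn; case: d min => [|d]; nia.
Qed.

Lemma val_inord (m k : nat) : (k <= m)%N -> (inord k : 'I_m.+1) = k :> nat.
Proof. by move=> km; rewrite inordK. Qed.

Section Gap.
Variables (R : rcfType) (p m : nat) (eps : R).
Hypotheses (p_pr : prime p) (p_odd : odd p) (eps2 : eps ^+ 2 = 1).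
Local Notation G := (unitri p m.+1).
Implicit Types (v : {ffun G -> R^o}) (k : nat) (I : 'I_m.+1).

(** The generators are indexed by natural numbers so that sums over them are
    interval sums. *)
Definition gen k : G := elem (inord k) (inord k.+1) 1.

Definition energy v : R :=
  \sum_(0 <= k < m) dot (defect eps (gen k) v) (defect eps (gen k) v).

(** The squared norm of [v] is the sum of those of its layers along row [I]. The
    first layer is bounded by [row_start], with a factor of the order of p,
    and [chain_step] bounds each further one by a fraction of the preceding
    one plus a defect of its own, so that the energy is used only once. *)
Lemma row_gap I v : (I.+1 < m)%N -> avg (row_group p I 1 m) v = 0 ->
  dot v v <= 400 * p%:R * energy v.
Proof.
move=> Im v0.
pose Q k := avg (row_group p I 1 k) v.
pose D k := dot (Q k - Q k.+1) (Q k - Q k.+1).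
pose E k := dot (defect eps (gen k) v) (defect eps (gen k) v).
have E0 k : 0 <= E k by exact: dot_ge0.
have Q0 : Q I.+1 = v.
  rewrite /Q avg_id // => x xR; suff -> : x = 1%g by rewrite shift1.
  apply: (row_eq xR (group1 _)) => w Iw.
  rewrite (row_out xR Iw); last by lia.
  by rewrite mxE -val_eqE ltn_eqF.
have sumD : dot v v = \sum_(I.+1 <= k < m) D k.
  have sub k : row_group p I 1 k \subset row_group p I 1 k.+1 by apply: row_groupS.
  under eq_bigr do rewrite /D dot_avgB //.
  under eq_bigr do rewrite -opprB.
  rewrite sumrN (telescope_sumr (fun k => dot (Q k) (Q k))) //=; last exact: ltnW.
  by rewrite Q0 /Q v0 linear0 sub0r opprK.
have sumE a b : (0 <= a)%N -> (a <= b)%N -> (b <= m)%N -> \sum_(a <= k < b) E k <= energy v.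
  move=> _ ab bm; have ge0 c e : 0 <= \sum_(c <= k < e) E k by apply: sumr_ge0.
  have -> : energy v = \sum_(0 <= k < m) E k by [].
  rewrite [leRHS](@big_cat_nat _ _ _ a) ?(leq_trans ab) //=.
  rewrite [X in _ <= _ + X](@big_cat_nat _ _ _ b) //=.
  have := ge0 0%N a; have := ge0 b m; lra.
have [d pd d4] := ceil_sqrt p.
have D1 : D I.+1 <= 32 * d%:R ^+ 2 * energy v.
  have := row_start p_pr eps2 (i := I) (j := inord I.+1) (k := inord I.+2) v.
  rewrite !val_inord // ?(ltnW Im) // => /(_ _ erefl erefl pd).
  rewrite -/(Q _) -{1}Q0.
  have -> : elem I (inord I.+1) 1 = gen I by rewrite /gen inord_val.
  have -> : elem (inord I.+1) (inord I.+2) 1 = gen I.+1 by [].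
  have nE k : nrm (defect eps (gen k) v) ^+ 2 = E k by exact: sqr_nrm.
  have := sumE I I.+2 isT (leqW (leqnSn _)) Im.
  rewrite big_nat_recr // big_nat1 -!nE /= -[D _]sqr_nrm.
  have n0 := nrm_ge0 (Q I.+1 - Q I.+2); have a0 := nrm_ge0 (defect eps (gen I) v).
  have b0 := nrm_ge0 (defect eps (gen I.+1) v).
  move: n0 a0 b0; move: (nrm (Q _ - _)).
  move: (nrm (defect eps (gen I) v)) (nrm (defect eps (gen I.+1) v)).
  move=> y z x x0 y0 z0 le1 le2; have d0 : 0 <= d%:R :> R by [].
  have rhs0 : 0 <= 4 * d%:R * (y + z) by rewrite !mulr_ge0 ?addr_ge0.
  have : x ^+ 2 <= (4 * d%:R * (y + z)) ^+ 2 by rewrite ler_sqr ?nnegrE.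
  move=> /le_trans; apply.
  rewrite -mulrA exprMn exprMn mulrA.
  have le3 : 4 ^+ 2 * (y + z) ^+ 2 <= 32 * energy v.
    by have := sqr_ge0 (y - z); rewrite sqrrB sqrrD; lra.
  rewrite mulrAC [leRHS]mulrAC ler_wpM2r ?sqr_ge0 //.
have step k : (I.+1 < k)%N -> (k < m)%N -> D k <= 2 / 3 * D k.-1 + 16 / 3 * E k.
  move=> Ik km; have k0 : k = k.-1.+1 by rewrite prednK // (ltn_trans _ Ik).
  have := @row_step R p m.+1 eps p_pr eps2 p_odd I (inord k) (inord k.+1) v.
  rewrite !val_inord ?(ltnW km) // => /(_ Ik erefl _ _ erefl erefl).
  by rewrite /D -k0.
have := sum_geometric_recursion (fun k => dot_ge0 _) step Im.
rewrite -sumD; have := sumE I.+2 m isT Im (leqnn _).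
have S0 : 0 <= energy v by apply: sumr_ge0 => k _; exact: dot_ge0.
have : d%:R ^+ 2 * energy v <= 4 * p%:R * energy v.
  by rewrite ler_wpM2r // -natrX -natrM ler_nat.
have : energy v <= p%:R * energy v by rewrite ler_peMl // ler1n prime_gt0.
lra.
Qed.

Lemma derived_rows0 : derived_rows p m 0 = 1%G.
Proof.
apply/trivGP/subsetP => x /patternP xN; rewrite inE; apply/eqP/unitri_eq => u v uv.
by rewrite xN // mxE -val_eqE ltn_eqF.
Qed.

Lemma avg_derived_shift i g v :
  avg (derived_rows p m i) (shift g v) = shift g (avg (derived_rows p m i) v).
Proof. by rewrite avg_shift (normP (derived_rows_norm i g)). Qed.

(** Between two consecutive terms of the normal filtration only the entries of
    row [I] remain. *)
Lemma derived_layer_row I v (N := derived_rows p m) :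
  avg (row_group p I 1 m) (avg (N I) v - avg (N I.+1) v) = 0.
Proof.
set w := _ - _.
have fixw : fixed_by (N I) w.
  move=> x xN; rewrite shiftB (@avg_fixed _ _ (N I)) // (@avg_fixed _ _ (N I.+1)) //.
  by apply: subsetP xN; apply: derived_rowsS.
have fixN : fixed_by (N I) (avg (row_group p I 1 m) w).
  move=> x xN; rewrite /avg shiftZ shift_sum; congr (_ *: _); apply: eq_bigr => r _.
  rewrite -shiftM -[(x * r)%g](mulKVg r) shiftM -conjgE fixw //.
  by rewrite memJ_norm // derived_rows_norm.
have := fixed_by_derived_rowsS fixN (@avg_fixed _ _ _ _); move/avg_id <-.
rewrite avg_avgr; last exact: row_group_derived.
by rewrite avgB avg_avgr ?derived_rowsS // avg_avgl // subrr.
Qed.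

Lemma sum_derived_layers v j (N := derived_rows p m)
    (w := fun i => avg (N i) v - avg (N i.+1) v) :
  \sum_(0 <= i < j) dot (w i) (w i) = dot v v - dot (avg (N j) v) (avg (N j) v).
Proof.
under eq_bigr do rewrite dot_avgB ?derived_rowsS // -opprB.
rewrite sumrN (telescope_sumr (fun i => dot (avg (N i) v) (avg (N i) v))) //.
by rewrite [N 0]derived_rows0 avg1 opprB.
Qed.

(** On functions without invariants under the commutator subgroup the energy
    dominates the squared norm with constant 400 p, whereas on the abelianization the
    best constant is of the order of p ^ 2. The normal filtration commutes
    with translations, so the energy of [v] is at least the sum of the
    energies of its layers, to each of which [row_gap] applies. *)
Lemma energy_gap v : avg (derived_rows p m m.-1) v = 0 ->
  dot v v <= 400 * p%:R * energy v.
Proof.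
move=> v0; pose N := derived_rows p m.
pose w (u : {ffun G -> R^o}) i := avg (N i) u - avg (N i.+1) u.
have -> : dot v v = \sum_(0 <= i < m.-1) dot (w v i) (w v i).
  by rewrite sum_derived_layers v0 linear0 subr0.
apply: le_trans (_ : \sum_(0 <= i < m.-1) 400 * p%:R * energy (w v i) <= _).
  rewrite big_nat [leRHS]big_nat; apply: ler_sum => i /= im.
  have iE : (inord i : 'I_m.+1) = i :> nat by rewrite val_inord //; lia.
  have := derived_layer_row (inord i) v; rewrite iE; apply: row_gap; rewrite iE; lia.
rewrite -mulr_sumr ler_wpM2l ?mulr_ge0 // /energy exchange_big.
apply: ler_sum => k _.
have defectw i : defect eps (gen k) (w v i) = w (defect eps (gen k) v) i.
  rewrite /w /defect !avgB !avgZ !avg_derived_shift shiftB scalerBr.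
  by rewrite !opprB addrACA [RHS]addrACA [- _ - _]addrC.
under eq_bigr do rewrite defectw.
by rewrite sum_derived_layers gerBl dot_ge0.
Qed.

End Gap.

(** * The averaging operator of a symmetric walk *)

Section Step.
Variables (R : rcfType) (gT : finGroupType) (s : nat -> gT) (m : nat).
Local Notation fn := {ffun gT -> R^o}.
Implicit Types (f g h u v w : fn) (x y z : gT) (k t : nat) (A : {group gT}).

Definition step f : fn :=
  ((2 * m)%:R^-1 : R) *: \sum_(0 <= k < m) (shift (s k) f + shift (s k)^-1 f).

Fact step_linear : linear step.
Proof.
move=> a f g; rewrite /step [a *: (_ *: _)]scalerA mulrC -scalerA -scalerDr.
congr (_ *: _); rewrite scaler_sumr -big_split; apply: eq_bigr => k _ /=.
by rewrite !linearP scalerDr addrACA.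
Qed.
HB.instance Definition _ := GRing.isLinear.Build R fn fn _ step step_linear.

Lemma stepD f g : step (f + g) = step f + step g.
Proof. exact: linearD. Qed.
Lemma stepB f g : step (f - g) = step f - step g.
Proof. exact: linearB. Qed.
Lemma stepZ a f : step (a *: f) = a *: step f.
Proof. exact: linearZ. Qed.

Lemma iter_stepB t f g : iter t step (f - g) = iter t step f - iter t step g.
Proof. by elim: t => //= t ->; rewrite linearB. Qed.

Lemma iter_stepZ t a f : iter t step (a *: f) = a *: iter t step f.
Proof. by elim: t => //= t ->; rewrite linearZ. Qed.

Lemma step_avg A : (forall k, s k \in 'N(A))%g ->
  forall f, step (avg A f) = avg A (step f).
Proof.
move=> nA f; rewrite /step avgZ [avg A (\sum_(_ <= _ < _) _)]linear_sum.
congr (_ *: _); apply: eq_bigr => k _.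
by rewrite /= avgD !avg_shift !(normP _) ?groupV.
Qed.

Lemma iter_step_avg A : (forall k, s k \in 'N(A))%g ->
  forall t f, iter t step (avg A f) = avg A (iter t step f).
Proof. by move=> nA; elim=> //= t IH f; rewrite IH step_avg. Qed.

Lemma dot_step f g : dot (step f) g = dot f (step g).
Proof.
rewrite /step dotZl dotZr dotC !dot_sumr; congr (_ * _); apply: eq_bigr => k _.
by rewrite !dotDr ![dot g _]dotC !dot_shiftl invgK addrC.
Qed.

Hypothesis m_gt0 : (0 < m)%N.

Let m0 : m%:R != 0 :> R. Proof. by rewrite pnatr_eq0 -lt0n. Qed.

(** The Dirichlet form of the walk, for [eps = 1], and its counterpart for the
    bottom of the spectrum, for [eps = -1]. *)
Lemma step_energy (eps : R) v : eps ^+ 2 = 1 ->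
  (2 * m)%:R * (dot v v - eps * dot (step v) v) =
  \sum_(0 <= k < m) dot (defect eps (s k) v) (defect eps (s k) v).
Proof.
move=> eps2.
have E : (2 * m)%:R * dot (step v) v =
    \sum_(0 <= k < m) dot v (shift (s k) v + shift (s k)^-1 v).
  rewrite dotC /step dotZr mulVKf ?dot_sumr // natrM mulf_neq0 //.
  by rewrite pnatr_eq0.
rewrite mulrBr mulrCA E [eps * _]mulr_sumr.
have -> : (2 * m)%:R * dot v v = \sum_(0 <= k < m) 2 * dot v v.
  by rewrite sumr_const_nat subn0 -mulr_natl natrM; ring.
rewrite -sumrB; apply: eq_bigr => k _; rewrite /defect dotDr !(dotBr, dotBl, dotZr, dotZl).
rewrite dot_shift [dot v (shift (s k)^-1 v)]dotC dot_shiftl invgK [dot (shift (s k) v) v]dotC.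
by rewrite [eps * (_ - _)]mulrBr [eps * (eps * _)]mulrA -expr2 eps2; ring.
Qed.

Lemma step_mean f : step (avg [set: gT] f) = avg [set: gT] f.
Proof.
move: (avg [set: gT] f) (@avg_fixed _ _ [set: gT]%G f) => g fixm.
rewrite /step (eq_bigr (fun=> (2 : R) *: g)); last first.
  by move=> k _; rewrite !fixm ?inE // scaler_nat mulr2n.
rewrite sumr_const_nat subn0 -scaler_nat !scalerA [X in X *: _](_ : _ = 1) ?scale1r //.
by rewrite natrM; field.
Qed.

Lemma step_bound f (B : R) : (forall x, `|f x| <= B) -> forall x, `|step f x| <= B.
Proof.
move=> fB x; rewrite ffunE sum_ffunE /GRing.scale /= normrM ger0_norm ?invr_ge0 //.
rewrite ler_pdivrMl ?ltr0n ?muln_gt0 //; apply: le_trans (ler_norm_sum _ _ _) _.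
have -> : (2 * m)%:R * B = \sum_(0 <= k < m) (B + B).
  by rewrite sumr_const_nat subn0 -mulr_natl natrM; ring.
apply: ler_sum => k _; rewrite !ffunE; apply: le_trans (ler_normD _ _) _.
by rewrite lerD.
Qed.

Lemma iter_step_bound t f (B : R) :
  (forall x, `|f x| <= B) -> forall x, `|iter t step f x| <= B.
Proof. by move=> fB; elim: t => //= t; apply: step_bound. Qed.

(** A self-adjoint operator is bounded by its numerical radius. The
    polarization identity for [v] and its image gives this without any
    spectral decomposition. *)
Lemma step_contract A (alpha : R) v : (forall k, s k \in 'N(A))%g -> 0 < alpha ->
    (forall u, avg A u = 0 -> `|dot (step u) u| <= alpha * dot u u) ->
  avg A v = 0 -> dot (step v) (step v) <= alpha ^+ 2 * dot v v.
Proof.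
move=> nA a0 form v0; set w := alpha^-1 *: step v.
have w0 : avg A w = 0 by rewrite avgZ -step_avg // v0 linear0 scaler0.
have := form (v + w); rewrite avgD v0 w0 addr0 => /(_ erefl) /(le_trans (ler_norm _)).
have := form (v - w); rewrite avgB v0 w0 subr0 => /(_ erefl).
rewrite ler_norml => /andP[le1 _] le2; move: le1 le2.
rewrite stepB stepD !dotBl !dotBr !dotDl !dotDr.
have -> : dot (step w) v = dot (step v) w by rewrite dot_step dotC.
have -> : dot w v = dot v w by rewrite dotC.
have -> : dot (step v) w = alpha^-1 * dot (step v) (step v) by rewrite dotZr.
have -> : dot w w = alpha^-1 ^+ 2 * dot (step v) (step v) by rewrite !dotE; ring.
move: (dot (step v) (step v)) (dot v v) (dot (step w) w) (dot v w) => S V Y Z.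
move=> le1 le2; have {le1 le2} :
    4 * (alpha^-1 * S) <= 2 * alpha * V + 2 * alpha * (alpha^-1 ^+ 2 * S) by lra.
have -> : 2 * alpha * (alpha^-1 ^+ 2 * S) = 2 * (alpha^-1 * S) by field; rewrite gt_eqF.
rewrite -(ler_pM2l a0) => H; have : alpha * (4 * (alpha^-1 * S)) = 4 * S by field; rewrite gt_eqF.
have : alpha * (2 * (alpha^-1 * S)) = 2 * S by field; rewrite gt_eqF.
move: H; rewrite mulrDr; lra.
Qed.

Lemma iter_step_contract A (alpha : R) t v : (forall k, s k \in 'N(A))%g -> 0 < alpha ->
    (forall u, avg A u = 0 -> `|dot (step u) u| <= alpha * dot u u) ->
  avg A v = 0 -> dot (iter t step v) (iter t step v) <= alpha ^+ (2 * t) * dot v v.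
Proof.
move=> nA a0 form v0; elim: t => [|t IH]; first by rewrite muln0 mul1r.
have := step_contract nA a0 form (v := iter t step v).
rewrite -iter_step_avg // v0 iter_fix ?linear0 // => /(_ erefl) /le_trans; apply.
by rewrite mulnS exprD -mulrA ler_wpM2l ?exprn_ge0 // ltW.
Qed.

(** Functions that factor through the abelianization. *)
Definition abelian_fun f := forall x y, shift (x * y) f = shift (y * x) f.

Lemma abelian_fun_shift f z : abelian_fun f -> abelian_fun (shift z f).
Proof.
by move=> cf x y; rewrite -!shiftM (cf (x * y)%g) shiftM (cf x y) -shiftM (cf z).
Qed.

Lemma step_abelian_fun f : abelian_fun f -> abelian_fun (step f).
Proof.
move=> cf x y; rewrite /step !shiftZ !shift_sum; congr (_ *: _).
by apply: eq_bigr => k _; rewrite !shiftD !(abelian_fun_shift _ cf x y).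
Qed.

Lemma iter_step_abelian_fun t f : abelian_fun f -> abelian_fun (iter t step f).
Proof. by move=> cf; elim: t => //= t; apply: step_abelian_fun. Qed.

Lemma shift_step z f : abelian_fun f -> shift z (step f) = step (shift z f).
Proof.
move=> cf; rewrite /step shiftZ shift_sum; congr (_ *: _).
by apply: eq_bigr => k _; rewrite shiftD -!shiftM !(cf z).
Qed.

Lemma shift_iter_step z t f : abelian_fun f ->
  shift z (iter t step f) = iter t step (shift z f).
Proof.
by move=> cf; elim: t => //= t <-; rewrite shift_step //; apply: iter_step_abelian_fun.
Qed.

Definition grad i f : fn := ((2 * m)%:R^-1 : R) *: (shift (s i) f - shift (s i)^-1 f).

Lemma grad_iter_step i t f : abelian_fun f -> grad i (iter t step f) = iter t step (grad i f).
Proof. by move=> cf; rewrite /grad !shift_iter_step // -iter_stepB -iter_stepZ. Qed.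

(** This bounds a moment of the walk. Weigh each path by [r] plus the number
    of its steps [s i] minus the number of its steps [(s i)^-1]. For a
    function on the abelianization all the positions of the marked step
    contribute equally, so the expectation of this weight times [f] is the
    left-hand side. On the other hand the weight is a martingale whose second
    moment after [t] steps is [r ^+ 2 + t / m], and an absolute value [w] is
    at most (w ^ 2 + a ^ 2) / (2 a). *)
Lemma gradient_moment f i (a : R) t x : abelian_fun f -> (forall x, `|f x| <= 1) ->
    (i < m)%N -> 0 < a -> forall r : R,
  `|(r *: iter t step f + t%:R *: iter t.-1 step (grad i f)) x| <=
     (r ^+ 2 + t%:R / m%:R + a ^+ 2) / (2 * a).
Proof.
move=> cf f1 im a0; elim: t x => [|t IH] x r.
  rewrite scale0r addr0 /= mul0r addr0 ffunE /GRing.scale /= normrM.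
  rewrite ler_pdivlMr ?mulr_gt0 //.
  apply: le_trans (_ : `|r| * (2 * a) <= _).
    by apply: ler_wpM2r; [rewrite mulr_ge0 // ltW | rewrite ler_piMr].
  by have := sqr_ge0 (`|r| - a); rewrite sqrrB real_normK ?num_real //; lra.
set F := iter t step f; set H := iter t.-1 step (grad i f) in IH *.
pose e j : R := (j == i)%:R.
(* Condition on the first step: it changes the weight [r] by [e j] or by its
   opposite. *)
have -> : r *: iter t.+1 step f + t.+1%:R *: iter t.+1.-1 step (grad i f) =
   (2 * m)%:R^-1 *: \sum_(0 <= j < m)
     (shift (s j) ((r + e j) *: F + t%:R *: H) +
      shift (s j)^-1 ((r - e j) *: F + t%:R *: H)).
  have -> : \sum_(0 <= j < m) (shift (s j) ((r + e j) *: F + t%:R *: H) +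
      shift (s j)^-1 ((r - e j) *: F + t%:R *: H)) =
      \sum_(0 <= j < m) (shift (s j) (r *: F + t%:R *: H) + shift (s j)^-1 (r *: F + t%:R *: H))
      + (shift (s i) F - shift (s i)^-1 F).
    have -> : shift (s i) F - shift (s i)^-1 F =
        \sum_(0 <= j < m) e j *: (shift (s j) F - shift (s j)^-1 F).
      rewrite (bigD1_seq i) ?mem_index_iota ?iota_uniq //= /e eqxx scale1r big1 ?addr0 //.
      by move=> j /negPf ->; rewrite scale0r.
    rewrite -big_split; apply: eq_bigr => j _ /=.
    rewrite scalerDl scalerBl ![shift _ (_ + _)]shiftD !(shiftB, shiftD, shiftZ).
    by apply/ffunP => y; rewrite !ffunE /GRing.scale /=; ring.
  rewrite scalerDr -[X in _ = _ + X]/(grad i F) grad_iter_step //.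
  rewrite -[X in _ = X + _]/(step (r *: F + t%:R *: H)) stepD !stepZ -addrA; congr (_ + _).
  rewrite -natr1 scalerDl scale1r /H; congr (_ + _).
  by case: (t) => [|t'] //=; rewrite !scale0r.
rewrite ffunE sum_ffunE /GRing.scale /= normrM ger0_norm ?invr_ge0 //.
rewrite ler_pdivrMl ?ltr0n ?muln_gt0 //; apply: le_trans (ler_norm_sum _ _ _) _.
apply: le_trans (_ : \sum_(0 <= j < m) (((r + e j) ^+ 2 + t%:R / m%:R + a ^+ 2) / (2 * a) +
   ((r - e j) ^+ 2 + t%:R / m%:R + a ^+ 2) / (2 * a)) <= _).
  apply: ler_sum => j _; rewrite ffunE; apply: le_trans (ler_normD _ _) _.
  by apply: lerD; rewrite [shift _ _ x]ffunE; apply: IH.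
have -> : \sum_(0 <= j < m) (((r + e j) ^+ 2 + t%:R / m%:R + a ^+ 2) / (2 * a) +
   ((r - e j) ^+ 2 + t%:R / m%:R + a ^+ 2) / (2 * a)) =
   \sum_(0 <= j < m) (r ^+ 2 + t%:R / m%:R + a ^+ 2) / a + \sum_(0 <= j < m) e j / a.
  rewrite -big_split; apply: eq_bigr => j _ /=.
  have : e j ^+ 2 = e j by rewrite /e; case: eqP => _; rewrite ?expr1n ?expr0n.
  by rewrite sqrrD sqrrB => ->; field; rewrite gt_eqF.
have -> : \sum_(0 <= j < m) e j / a = 1 / a.
  rewrite (bigD1_seq i) ?mem_index_iota ?iota_uniq //= /e eqxx big1 ?addr0 //.
  by move=> j /negPf ->; rewrite mul0r.
rewrite sumr_const_nat subn0 -[X in X + _]mulr_natl natrM -natr1.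
have mn := m0; rewrite le_eqVlt; apply/orP; left; apply/eqP; field.
by rewrite mn gt_eqF.
Qed.

(** The walk smoothes: choosing [a] of the order of the square root of t / m
    makes the variation of the order of its inverse. *)
Lemma gradient_bound f i (a : R) t x : abelian_fun f -> (forall x, `|f x| <= 1) ->
    (i < m)%N -> 0 < a ->
  `|iter t step f (x * s i)%g - iter t step f (x * (s i)^-1)%g| <=
     (1 + a ^+ 2 * m%:R / t.+1%:R) / a.
Proof.
move=> cf f1 im a0; have := gradient_moment t.+1 x cf f1 im a0 0.
rewrite scale0r add0r expr0n add0r /= -grad_iter_step // /grad !ffunE /GRing.scale /=.
set d := _ - _; rewrite !normrM normr_nat [`|_^-1|]ger0_norm ?invr_ge0 // mulrA.
have m_gt : 0 < m%:R :> R by rewrite ltr0n.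
have t_gt : 0 < t.+1%:R :> R by [].
have -> : t.+1%:R / (2 * m)%:R = t.+1%:R / (2 * m%:R) :> R by rewrite natrM.
rewrite -ler_pdivlMl ?divr_gt0 ?mulr_gt0 //; move=> /le_trans; apply.
rewrite le_eqVlt; apply/orP; left; apply/eqP; field.
by rewrite nat1r !gt_eqF.
Qed.

End Step.

Lemma sub_mean_le (R : rcfType) (gT : finGroupType) (f : {ffun gT -> R^o}) (c : R) :
  (forall x y, `|f x - f y| <= c) -> forall x, `|f x - avg [set: gT] f x| <= c.
Proof.
move=> osc x.
have T0 : #|[set: gT]|%:R != 0 :> R by apply: (card_group_unit R [set: gT]%G).
have -> : f x - avg [set: gT] f x =
    #|[set: gT]|%:R^-1 * \sum_(a in [set: gT]) (f x - f (x * a)%g).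
  rewrite ffunE sum_ffunE sumrB sumr_const mulrBr -[f x *+ _]mulr_natl mulKf //.
  by congr (_ - _ * _); apply: eq_bigr => a _; rewrite ffunE.
rewrite normrM ger0_norm ?invr_ge0 // ler_pdivrMl; last by rewrite lt0r T0 ler0n.
apply: le_trans (ler_norm_sum _ _ _) _; rewrite mulr_natl -sumr_const.
by apply: ler_sum => a _; apply: osc.
Qed.

(** Steps from [x * s^-1] to [x * s] move by [s ^+ 2], and these reach all
    powers of [s] because its order is odd. *)
Lemma odd_order_osc (R : rcfType) (gT : finGroupType) (f : {ffun gT -> R^o})
    (s : gT) (p : nat) (c : R) :
    odd p -> (s ^+ p = 1)%g -> (forall x, `|f (x * s)%g - f (x * s^-1)%g| <= c) ->
  forall x j, (j < p)%N -> `|f (x * s ^+ j)%g - f x| <= p%:R * c.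
Proof.
move=> p_odd sp1 grad x j jp.
have c0 : 0 <= c by apply: le_trans (normr_ge0 _) (grad 1%g).
have step2 l : `|f (x * s ^+ (2 * l))%g - f x| <= l%:R * c.
  elim: l => [|l IH]; first by rewrite muln0 mulg1 subrr normr0 mul0r.
  have := grad (x * s ^+ (2 * l).+1)%g.
  rewrite -!mulgA -expgSr [(s ^+ (2 * l).+1)%g]expgSr mulgK => le1.
  rewrite mulnS add2n; apply: le_trans (ler_distD (f (x * s ^+ (2 * l))%g) _ _) _.
  by rewrite -nat1r mulrDl mul1r lerD.
have [l lp ->] : exists2 l, (l <= p)%N & (s ^+ j = s ^+ (2 * l))%g.
  case jo: (odd j).
    (* An odd power is also the even power with exponent [j + p]. *)
    exists ((j + p)./2); first by rewrite -divn2; lia.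
    by rewrite mul2n halfK oddD jo p_odd subn0 expgD sp1 mulg1.
  by exists j./2; [rewrite -divn2; lia | rewrite mul2n halfK jo subn0].
by apply: le_trans (step2 l) _; rewrite ler_wpM2r // ler_nat.
Qed.

(** * The abelianization of the unitriangular group *)

Section Superdiagonal.
Variables p m : nat.
Local Notation G := (unitri p m.+1).
Local Notation gen := (gen p m).
Implicit Types (x y z : G) (k l : nat).

(** The superdiagonal entries are the coordinates of the abelianization. *)
Definition superdiag k x : 'F_p := x (inord k) (inord k.+1).

Lemma superdiagM k x y : (k < m)%N -> superdiag k (x * y)%g = superdiag k x + superdiag k y.
Proof.
move=> km; have kE := val_inord (ltnW km); have lE := val_inord km.
rewrite /superdiag mxE (bigD1 (inord k)) //= (bigD1 (inord k.+1)) /=; last first.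
  by rewrite -val_eqE /= kE lE gtn_eqF.
rewrite (unitri_entry x (leqnn _)) (unitri_entry y (leqnn _)) !eqxx mul1r mulr1.
rewrite big1 ?addr0 1?addrC // => w.
move=> /andP[]; rewrite -!val_eqE /= kE lE => wk wl.
case: (ltnP w k) => [lt|ge].
  rewrite [x _ _]unitri_entry ?kE 1?ltnW // -[_ == w]val_eqE /= kE gtn_eqF //.
  by rewrite mul0r.
have lw : (k.+1 < w)%N by lia.
rewrite [y _ _]unitri_entry ?lE 1?ltnW // -[w == _]val_eqE /= lE gtn_eqF //.
by rewrite mulr0.
Qed.

Lemma superdiag1 k : (k < m)%N -> superdiag k 1%g = 0.
Proof.
by move=> km; rewrite /superdiag mxE -val_eqE /= !val_inord ?(ltnW km) // ltn_eqF.
Qed.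

Lemma superdiagV k x : (k < m)%N -> superdiag k x^-1%g = - superdiag k x.
Proof.
by move=> km; apply/eqP; rewrite -addr_eq0 -superdiagM // mulVg superdiag1.
Qed.

Lemma superdiagX k x (a : nat) : (k < m)%N -> superdiag k (x ^+ a)%g = superdiag k x *+ a.
Proof.
move=> km; elim: a => [|a IH]; first by rewrite superdiag1.
by rewrite expgS superdiagM // IH mulrS.
Qed.

Lemma superdiag_gen k l : (k < m)%N -> (l < m)%N -> superdiag k (gen l) = (k == l)%:R.
Proof.
move=> km lm; rewrite /superdiag elemE ?val_inord ?(ltnW lm) //.
rewrite -!val_eqE /= !val_inord ?(ltnW km) ?(ltnW lm) // ltn_eqF // add0r mul1r.
by rewrite eqSS andbb.
Qed.

Lemma derived_superdiag x : (forall k, (k < m)%N -> superdiag k x = 0) ->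
  x \in derived_rows p m m.-1.
Proof.
move=> x0; apply/patternP => u v uv nP.
have um : (u < m)%N by apply: leq_trans uv _; rewrite -ltnS.
have vE : v = u.+1 :> nat.
  move: nP (ltn_ord v); rewrite /derived_pat /=; lia.
by have := x0 u um; rewrite /superdiag inord_val -vE inord_val.
Qed.

Lemma derived_abelian_fun (R : rcfType) (f : {ffun G -> R^o}) :
  fixed_by (derived_rows p m m.-1) f -> abelian_fun f.
Proof.
move=> fixf x y; have zN : ((y * x)^-1 * (x * y))%g \in derived_rows p m m.-1.
  apply: derived_superdiag => k km; rewrite superdiagM // superdiagV // !superdiagM //.
  by rewrite [_ y + _]addrC addNr.
by rewrite -{1}[(x * y)%g](mulKVg (y * x)%g) (shiftM (y * x)%g) (fixf _ zN).
Qed.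

Lemma elem_exp_p (i j : 'I_m.+1) (a : 'F_p) : prime p -> (i < j)%N -> (elem i j a ^+ p = 1)%g.
Proof.
by move=> pp ij; rewrite elemX // -mulr_natl pchar_Fp_0 // mul0r elem0.
Qed.

(** Modulo the commutator subgroup every element is a product of one power of
    each generator. *)
Lemma derived_osc (R : rcfType) (f : {ffun G -> R^o}) (c : R) :
    prime p -> odd p -> fixed_by (derived_rows p m m.-1) f ->
    (forall x k, (k < m)%N -> `|f (x * gen k)%g - f (x * (gen k)^-1)%g| <= c) ->
  forall x y, `|f x - f y| <= m%:R * (p%:R * c).
Proof.
move=> p_pr p_odd fixf grad x y.
pose a k : nat := superdiag k (x^-1 * y)%g.
pose h j : G := (\prod_(0 <= k < j) gen k ^+ a k)%g.
have hS j : h j.+1 = (h j * gen j ^+ a j)%g by rewrite /h big_nat_recr.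
have osc j : (j <= m)%N -> `|f (x * h j)%g - f x| <= j%:R * (p%:R * c).
  elim: j => [_|j IH jm]; first by rewrite /h big_geq // mulg1 subrr normr0 mul0r.
  rewrite hS mulgA; apply: le_trans (ler_distD (f (x * h j)%g) _ _) _.
  rewrite -nat1r mulrDl mul1r lerD ?IH ?(ltnW jm) //.
  apply: odd_order_osc => //; last by rewrite /a -[X in (_ < X)%N](Fp_cast p_pr) ltn_ord.
    by apply: elem_exp_p => //; rewrite !val_inord ?(ltnW jm).
  by move=> z; apply: grad.
have sdh j l : (j <= m)%N -> (l < m)%N ->
    superdiag l (h j) = if (l < j)%N then superdiag l (x^-1 * y)%g else 0.
  elim: j => [_ lm|j IH jm lm]; first by rewrite /h big_geq // superdiag1.
  rewrite hS superdiagM // IH ?(ltnW jm) // superdiagX // superdiag_gen // ltnS.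
  have [->|lj] := eqVneq l j; first by rewrite ltnn leqnn add0r natr_Zp.
  by rewrite mul0rn addr0 [(l <= j)%N]leq_eqVlt (negPf lj).
have zN : ((h m)^-1 * (x^-1 * y))%g \in derived_rows p m m.-1.
  apply: derived_superdiag => k km; rewrite superdiagM // superdiagV // sdh // km.
  by rewrite addNr.
have -> : f y = f (x * h m)%g.
  have /ffunP/(_ (x * h m)%g) := fixf _ zN; rewrite ffunE => <-.
  by rewrite -!mulgA mulKVg mulKVg.
by rewrite distrC osc.
Qed.

End Superdiagonal.

Section Walk.
Variables (R : realType) (p m : nat).
Hypotheses (p_pr : prime p) (p_odd : odd p).
Local Notation G := (unitri p m.+1).
Local Notation gen := (gen p m).

(** The generators and their inverses are pairwise distinct since [p] is odd,
    so the sum over the support of the walk has [2 * m] terms. *)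
Lemma sum_step_mx (F : G -> R) :
  \sum_(g : G | step_mx g) F g = \sum_(0 <= k < m) (F (gen k) + F (gen k)^-1%g).
Proof.
pose h (u : 'I_m * bool) : G := if u.2 then gen u.1 else (gen u.1)^-1%g.
have sdh k u : (k < m)%N -> superdiag k (h u) = (if u.2 then 1 else -1) *+ (k == u.1).
  move=> km; rewrite /h; case: u.2; rewrite ?superdiagV // superdiag_gen //.
  by rewrite mulNrn.
have h_inj : injective h.
  move=> [k b] [l c] E; have := sdh k (k, b) (ltn_ord k); rewrite E sdh //= eqxx mulr1n.
  have one0 : (1 : 'F_p) != 0 := oner_neq0 _.
  have two : (1 == -1 :> 'F_p) = false.
    by apply/negbTE; rewrite -addr_eq0 -mulr2n Fp2_neq0.
  have [/val_inj <-|_] := eqVneq (k : nat) l; last first.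
    by rewrite mulr0n; case: b {E} => /esym/eqP; rewrite ?oppr_eq0 (negPf one0).
  rewrite mulr1n; case: b c {E} => [] [] // /eqP; rewrite ?two // eq_sym two //.
transitivity (\sum_(g in h @: [set: 'I_m * bool]) F g).
  have h_val (k : 'I_m) b : unitri_val (h (k, b)) =
      1%:M + (if b then 1 else -1) *: delta_mx (inord k) (inord k.+1).
    have kk : ((inord k : 'I_m.+1) < (inord k.+1 : 'I_m.+1))%N.
      by rewrite !val_inord // ltnW.
    case: b; first exact: val_elem kk.
    by rewrite -[h _]/((gen k)^-1)%g /gen -elemV // val_elem.
  apply: eq_bigl => g; apply/existsP/imsetP => [[i /existsP[j /andP[/eqP ji]]]|[[k b] _ ->]].
    have im : (i < m)%N by rewrite -ltnS -ji ltn_ord.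
    have jE : j = inord i.+1 by apply/val_inj; rewrite /= inordK -ji.
    have iE : i = inord (Ordinal im) by rewrite inord_val.
    case/orP => /eqP gE; [exists (Ordinal im, true)|exists (Ordinal im, false)] => //;
      apply/val_inj; rewrite [LHS]gE [RHS]h_val -iE -jE ?scale1r ?scaleN1r //.
  exists (inord k); apply/existsP; exists (inord k.+1).
  rewrite !val_inord ?(ltnW (ltn_ord k)) // eqxx h_val.
  by case: b; rewrite ?scale1r ?scaleN1r eqxx ?orbT.
rewrite big_imset /=; last by move=> u v _ _; apply: h_inj.
rewrite big_mkord (eq_bigl predT); last by move=> u; rewrite inE.
rewrite -(pair_bigA _ (fun k b => F (h (k, b)))) /=.
by apply: eq_bigr => k _; rewrite big_bool.
Qed.

Lemma walkE (f : {ffun G -> R^o}) x : \sum_y walk R x y * f y = step gen m f x.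
Proof.
rewrite (reindex_inj (mulgI x)) /= ffunE sum_ffunE /GRing.scale /= mulr_sumr.
under eq_bigr do rewrite walk_mulg.
rewrite (bigID (fun g => step_mx (unitri_val g))) /= [X in _ + X]big1 ?addr0; last first.
  by move=> g /negPf ->; rewrite mul0r.
transitivity (\sum_(g : G | step_mx g) ((2 * m)%:R^-1 * f (x * g)%g)).
  by apply: eq_bigr => g ->; rewrite subn1.
by rewrite sum_step_mx; apply: eq_bigr => k _; rewrite !ffunE mulrDr.
Qed.

Lemma walknS t (x y : G) : walkn R t.+1 x y = \sum_w walkn R t w y * walk R x w.
Proof.
case: t => //=; rewrite (bigD1 y) //= eqxx mul1r big1 ?addr0 // => w.
by move=> /negPf ->; rewrite mul0r.
Qed.

Lemma walkn_step t (f : {ffun G -> R^o}) x :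
  \sum_y walkn R t x y * f y = iter t (step gen m) f x.
Proof.
elim: t x => [|t IH] x.
  rewrite (bigD1 x) //= eqxx mul1r big1 ?addr0 // => y /negPf.
  by rewrite eq_sym => ->; rewrite mul0r.
rewrite iterS -walkE; under [RHS]eq_bigr do rewrite -IH mulr_sumr.
rewrite exchange_big; apply: eq_bigr => y _.
rewrite walknS mulr_suml; apply: eq_bigr => w _.
by rewrite mulrAC [_ * walk R x w]mulrC mulrA.
Qed.

End Walk.

(** * Mixing time *)

Lemma expR_quotient (R : realType) (y : R) :
  expR (- (4 * y)) * (4 * expR y) = 4 / expR (3 * y).
Proof.
have -> : - (4 * y) = - (3 * y) - y by ring.
rewrite expRD !expRN.
have y0 : expR y != 0 by rewrite gt_eqF ?expR_gt0.
have z0 : expR (3 * y) != 0 by rewrite gt_eqF ?expR_gt0.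
move: (expR y) (expR (3 * y)) y0 z0 => a b a0 b0.
by field; rewrite a0 b0.
Qed.

Section Mixing.
Variables (R : realType) (p m : nat).
Hypotheses (p_pr : prime p) (p_odd : odd p) (m_gt0 : (0 < m)%N).
Local Notation G := (unitri p m.+1).
Local Notation gen := (gen p m).
Local Notation W := (step (R := R) gen m).
Local Notation N := (derived_rows p m m.-1).
Local Notation mean f := (avg [set: G] f).
Implicit Types (f g : {ffun G -> R^o}).

Let p_gt0 : 0 < p%:R :> R. Proof. by rewrite ltr0n prime_gt0. Qed.
Let m_gt0R : 0 < m%:R :> R. Proof. by rewrite ltr0n. Qed.

Lemma step_form_bound f : avg N f = 0 ->
  `|dot (W f) f| <= (1 - (800 * m%:R * p%:R)^-1) * dot f f.
Proof.
move=> f0; have pm0 : 0 < 800 * m%:R * p%:R :> R by rewrite !mulr_gt0.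
have bound (e : R) : e ^+ 2 = 1 -> e * dot (W f) f <= (1 - (800 * m%:R * p%:R)^-1) * dot f f.
  move=> e2; have := step_energy gen m_gt0 f e2.
  have := energy_gap p_pr p_odd e2 f0; rewrite /energy => gap E.
  rewrite -E natrM in gap; rewrite mulrBl mul1r lerBrDl -lerBrDr ler_pdivrMl //.
  by apply: le_trans gap _; rewrite le_eqVlt; apply/orP; left; apply/eqP; ring.
have := bound 1 (expr1n _ _); have := bound (-1) (etrans (sqrrN 1) (expr1n _ _)).
rewrite mul1r mulN1r ler_norml => le1 ->; rewrite andbT lerNl //.
Qed.

Lemma card_unitri_le : (#|{: G}| <= p ^ (m.+1 * m.+1))%N.
Proof.
have <- : #|{: 'M['F_p]_m.+1}| = (p ^ (m.+1 * m.+1))%N by rewrite card_mx card_Fp.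
by rewrite -(card_codom (f := @unitri_val p m.+1) val_inj) max_card.
Qed.

(** The contraction factor [alpha] per step has [1 - alpha] of the order of 1
    / (m p). Passing from the quadratic norm to the supremum costs the
    cardinal of the group, at most exp (p n ^ 2), which a number of steps of
    the order of p ^ 2 n ^ 4 beats even for bounded n. On the abelianization
    the gap is smaller by a factor p, and this argument would lose a factor
    log p. *)
Lemma nonabelian_decay f t : avg N f = 0 -> (forall x, `|f x| <= 2) ->
    (800 * p ^ 2 * m.+1 ^ 4 <= t)%N -> (2 <= m.+1)%N ->
  forall x, `|iter t W f x| <= 3 / 8.
Proof.
move=> f0 f2 tT n2 x.
pose alpha : R := 1 - (800 * m%:R * p%:R)^-1.
have D0 : 0 < 800 * m%:R * p%:R :> R by rewrite !mulr_gt0.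
have D1 : 1 < 800 * m%:R * p%:R :> R.
  by rewrite -!natrM ltr1n; have := prime_gt1 p_pr; have := m_gt0; nia.
have alpha0 : 0 < alpha by rewrite subr_gt0 invf_lt1.
have nN k : gen k \in 'N(N)%g by exact: derived_rows_norm.
have := iter_step_contract t nN alpha0 step_form_bound f0 => le1.
have ff : dot f f <= 4 * #|{: G}|%:R.
  apply: le_trans (_ : \sum_(y : G) 4 <= _).
    apply: ler_sum => y _; rewrite -expr2 -real_normK ?num_real //.
    by have := f2 y; have := normr_ge0 (f y); nra.
  by rewrite sumr_const -[leLHS]mulr_natr.
suff le2 : alpha ^+ (2 * t) * (4 * #|{: G}|%:R) <= (3 / 8) ^+ 2.
  rewrite -ler_sqr ?nnegrE //; last by lra.
  rewrite real_normK ?num_real //; apply: le_trans (le_sqr_dot _ _) _.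
  apply: le_trans le1 _; apply: le_trans le2; apply: ler_wpM2l => //.
  by rewrite exprn_ge0 // ltW.
pose q : R := p%:R * (m.+1 * m.+1)%:R.
have cardE : #|{: G}|%:R <= expR q :> R.
  apply: le_trans (_ : (p%:R ^+ (m.+1 * m.+1)) <= _).
    by rewrite -natrX ler_nat card_unitri_le.
  rewrite /q expRM_natr lerXn2r ?nnegrE ?expR_ge0 ?ler0n //.
  by apply: le_trans (expR_ge1Dx _); rewrite lerDr.
have alphaE : alpha ^+ (2 * t) <= expR (- (4 * q)).
  apply: le_trans (_ : expR (- (800 * m%:R * p%:R)^-1) ^+ (2 * t) <= _).
    rewrite lerXn2r ?nnegrE ?expR_ge0 ?(ltW alpha0) //.
    by apply: le_trans (expR_ge1Dx _).
  rewrite -expRM_natr ler_expR mulNr lerN2 ler_pdivlMl // /q -!natrM ler_nat.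
  apply: leq_trans (leq_mul (leqnn 2) tT); move: 800%N => C.
  have := leq_mul (leqnn (C * (p * p) * (m.+1 * m.+1) * 2)%N) (leq_mul n2 (leqnSn m)).
  rewrite -[(p ^ 2)%N]mulnn -[(m.+1 ^ 4)%N]/(m.+1 * (m.+1 * (m.+1 * m.+1)))%N.
  by clear; move: m.+1 => n; congr (_ <= _)%N; ring.
apply: le_trans (_ : expR (- (4 * q)) * (4 * expR q) <= _).
  by rewrite ler_pM ?exprn_ge0 ?(ltW alpha0) ?mulr_ge0 ?ler0n // ler_wpM2l.
rewrite expR_quotient.
have q12 : 12 <= q.
  have p3 : (3 <= p)%N.
    by rewrite ltn_neqAle prime_gt1 // andbT; apply: contraTneq p_odd => <-.
  by rewrite /q -natrM ler_nat; apply: leq_mul p3 (leq_mul n2 n2).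
rewrite ler_pdivrMr ?expR_gt0 //; have := expR_ge1Dx (3 * q); lra.
Qed.

(** The variation along each generator is at most of the order of the square
    root of m / t, and a distance of at most [m * p] generators has to be
    covered. *)
Lemma abelian_decay f t : fixed_by N f -> (forall x, `|f x| <= 1) ->
    (256 * p ^ 2 * m ^ 3 <= t)%N ->
  forall x, `|iter t W f x - mean f x| <= 1 / 8.
Proof.
move=> fixf f1 tT x.
have cf := derived_abelian_fun fixf.
have nN k : gen k \in 'N(N)%g by exact: derived_rows_norm.
have nT k : gen k \in 'N([set: G])%g by rewrite (subsetP (normG _)) ?inE.
have meanE : mean f = mean (iter t W f).
  by rewrite -(@iter_step_avg R _ gen m [set: G]%G nT) iter_fix // step_mean.
rewrite meanE.
apply: sub_mean_le => y z.
(* With this [a] the oscillation is (1 + b) / 16, where [b <= 1] by the bound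
   on [t]. *)
pose a : R := 16 * p%:R * m%:R.
have a0 : 0 < a by rewrite !mulr_gt0.
have grad u k : (k < m)%N -> `|iter t W f (u * gen k)%g - iter t W f (u * (gen k)^-1)%g| <=
    (1 + a ^+ 2 * m%:R / t.+1%:R) / a.
  by move=> km; apply: gradient_bound.
have fixF : fixed_by N (iter t W f).
  by rewrite -(avg_id fixf) (@iter_step_avg R _ gen m _ nN); apply: avg_fixed.
apply: le_trans (derived_osc p_pr p_odd fixF grad y z) _.
have : a ^+ 2 * m%:R / t.+1%:R <= 1.
  rewrite ler_pdivrMr // mul1r /a -!natrM -natrX -natrM ler_nat.
  apply: leq_trans (leqW tT); rewrite -!mulnn; rewrite !expnS expn0; nia.
move: (a ^+ 2 * m%:R / t.+1%:R) => b b1.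
have -> : m%:R * (p%:R * ((1 + b) / a)) = (1 + b) / 16.
  by rewrite /a; field; rewrite !gt_eqF.
lra.
Qed.

Lemma avg_bound (A : {group G}) f :
  (forall x, `|f x| <= 1) -> forall y, `|avg A f y| <= 1.
Proof.
move=> f1 y; rewrite ffunE sum_ffunE /GRing.scale /= normrM ger0_norm ?invr_ge0 //.
rewrite ler_pdivrMl ?ltr0n ?cardG_gt0 // mulr1.
apply: le_trans (ler_norm_sum _ _ _) _; rewrite -sumr_const.
by apply: ler_sum => a _; rewrite ffunE.
Qed.

(** The function splits into its average over the commutator subgroup and the
    rest, whose contributions are at most 1 / 8 and 3 / 8. *)
Lemma halving f : (forall x, `|f x| <= 1) ->
  forall x, `|iter (800 * p ^ 2 * m.+1 ^ 4) W f x - mean f x| <= 1 / 2.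
Proof.
move=> f1 x; set t := (_ * _)%N.
have subE (u v : {ffun G -> R^o}) y : (u - v) y = u y - v y by rewrite !ffunE.
have -> : iter t W f x - mean f x =
    (iter t W (avg N f) x - mean (avg N f) x) + iter t W (f - avg N f) x.
  rewrite (avg_avgr (B := [set: G]%G)) ?subsetT // iter_stepB.
  by rewrite subE [RHS]addrC addrA subrK.
apply: le_trans (ler_normD _ _) _.
have n2 : (2 <= m.+1)%N by rewrite ltnS.
have ab : `|iter t W (avg N f) x - mean (avg N f) x| <= 1 / 8.
  apply: abelian_decay; [exact: avg_fixed | exact: avg_bound | ].
  rewrite /t leq_mul // -?[(m.+1 ^ 4)%N]/(m.+1 * m.+1 ^ 3)%N; first by rewrite leq_mul.
  by apply: leq_trans (leq_pmull _ _) => //; rewrite leq_exp2r.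
have na : `|iter t W (f - avg N f) x| <= 3 / 8.
  apply: nonabelian_decay => //; first by rewrite avgB avg_avgl // subrr.
  move=> y; rewrite subE; apply: le_trans (ler_normB _ _) _.
  by have := f1 y; have := avg_bound N f1 y; lra.
by move: ab na; lra.
Qed.

Lemma iter_step_mean t f : iter t W (mean f) = mean f.
Proof. by rewrite iter_fix // step_mean. Qed.

Lemma mean_iter_step t f : mean (iter t W f) = mean f.
Proof.
rewrite -[RHS](iter_step_mean t) (@iter_step_avg R _ gen m [set: G]%G) // => k.
by rewrite (subsetP (normG _)) ?inE.
Qed.

Lemma iterated_halving f (k r : nat) : (forall x, `|f x| <= 1) ->
  forall x, `|iter (r + k * (800 * p ^ 2 * m.+1 ^ 4)) W f x - mean f x| <= 2 / 2 ^+ k.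
Proof.
move=> f1 x; set T := (800 * _ * _)%N; set h := f - mean f.
have subE (u v : {ffun G -> R^o}) y : (u - v) y = u y - v y by rewrite !ffunE.
have hE u y : iter u W h y = iter u W f y - mean f y.
  by rewrite /h iter_stepB iter_step_mean subE.
have h0 u : mean (iter u W h) = 0.
  by rewrite mean_iter_step /h avgB (@avg_avgl _ _ [set: G]%G [set: G]%G) ?subrr.
rewrite -hE iterD; apply: iter_step_bound => // y; elim: k y => [|k IH] y.
  rewrite mul0n expr0 divr1 subE; apply: le_trans (ler_normB _ _) _.
  rewrite -[2]/(1 + 1); apply: lerD => //.
  exact: (avg_bound [set: G]%G f1).
have c0 : 0 < 2 / 2 ^+ k :> R by rewrite divr_gt0 ?exprn_gt0.
rewrite mulSn iterD; set g := iter (k * T) W h in IH *.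
have := @halving ((2 / 2 ^+ k)^-1 *: g) _ y; rewrite iter_stepZ avgZ h0 scaler0.
have scaleE a (u : {ffun G -> R^o}) z : (a *: u) z = a * u z by rewrite ffunE.
have zeroE : (0 : {ffun G -> R^o}) y = 0 by rewrite ffunE.
rewrite scaleE zeroE subr0 normrM gtr0_norm ?invr_gt0 // ler_pdivrMl //.
move=> le; apply: le_trans (le _) _.
  move=> z; rewrite scaleE normrM gtr0_norm ?invr_gt0 //.
  by rewrite ler_pdivrMl // mulr1; apply: IH.
by rewrite mul1r exprSr invfM mulrA.
Qed.

End Mixing.

(** The total variation distance is attained by testing against the sign of
    the difference of the two distributions. *)
Lemma tv_dist_walkn (R : realType) (p m t : nat) (x : unitri p m.+1) :
    prime p -> odd p -> exists2 f : {ffun unitri p m.+1 -> R^o},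
    forall y, `|f y| <= 1 &
  2 * tv_dist (walkn R t x) (@uniform R (unitri p m.+1)) =
    iter t (step (gen p m) m) f x - avg [set: unitri p m.+1] f x.
Proof.
move=> p_pr p_odd; pose d y := walkn R t x y - @uniform R (unitri p m.+1) y.
exists [ffun y => Num.sg (d y)] => [y|].
  by rewrite ffunE normr_sg; case: (d y != 0).
rewrite /tv_dist mulrA divff ?pnatr_eq0 // mul1r -(walkn_step p_pr p_odd).
have -> : avg [set: unitri p m.+1] ([ffun y => Num.sg (d y)] : {ffun _ -> R^o}) x =
    \sum_y uniform R y * Num.sg (d y).
  rewrite ffunE sum_ffunE /GRing.scale /= cardsT mulr_sumr [RHS](reindex_inj (mulgI x)).
  by apply: eq_big => [a|a _]; rewrite ?inE // !ffunE.
rewrite -sumrB; apply: eq_bigr => y _.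
by rewrite ffunE -mulrBl -/(d y) mulrC -normrEsg.
Qed.

Theorem theorem1 (R : realType) :
  exists b d : R, 0 < b /\ 0 < d /\
    exists p0 : nat,
      forall p : nat, prime p -> odd p -> (p0 <= p)%N ->
      forall n : nat, (2 <= n)%N ->
      forall c : R, 0 < c ->
      forall t : nat, c * b * p%:R ^+ 2 * n%:R ^+ 4 <= t%:R ->
      forall x : unitri p n,
        4 * tv_dist (walkn R t x) (@uniform R (unitri p n)) ^+ 2
          <= d * expR (- c).
Proof.
exists 800, (4 * expR 1); split=> //; split; first by rewrite mulr_gt0 ?expR_gt0.
exists 0%N => p p_pr p_odd _ [//|m] m0 c c0 t tc x.
have [f f1 tvE] := @tv_dist_walkn R p m t x p_pr p_odd.
pose T := (800 * p ^ 2 * m.+1 ^ 4)%N; pose k := (t %/ T)%N.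
have T0 : (0 < T)%N.
  by rewrite /T -mulnA muln_gt0 (@muln_gt0 (p ^ 2)) !expn_gt0 (prime_gt0 p_pr).
have ck : c <= 1 + k%:R.
  rewrite nat1r; apply/ltW; rewrite -(ltr_pM2r (_ : 0 < T%:R)) ?ltr0n // -natrM.
  apply: le_lt_trans (_ : t%:R < _); last by rewrite ltr_nat ltn_ceil.
  have TE : T%:R = 800 * p%:R ^+ 2 * m.+1%:R ^+ 4 :> R by rewrite -!natrX -!natrM.
  by have -> : c * T%:R = c * 800 * p%:R ^+ 2 * m.+1%:R ^+ 4 by rewrite TE; ring.
have := iterated_halving p_pr p_odd m0 k (t %% T) f1 x.
rewrite -/T addnC -divn_eq -tvE; set D := tv_dist _ _ => le1.
have D0 : 0 <= 2 * D.
  by rewrite mulr_ge0 // /D /tv_dist mulr_ge0 ?invr_ge0 // sumr_ge0.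
rewrite ger0_norm // in le1.
(* Each block of [T] steps halves the distance, hence divides its square by 4,
   and 1 / 4 <= exp (-1). *)
have half : 2^-1 <= expR (- 2^-1) :> R by apply: le_trans (expR_ge1Dx _); lra.
have -> : 4 * D ^+ 2 = (2 * D) ^+ 2 by ring.
apply: le_trans (_ : (2 / 2 ^+ k) ^+ 2 <= _); first by rewrite ler_sqr ?nnegrE // (le_trans D0).
rewrite exprMn -mulrA; have -> : 2 ^+ 2 = 4 :> R by ring.
rewrite ler_pM2l // -expRD.
apply: le_trans (_ : (expR (- 2^-1) ^+ k) ^+ 2 <= _).
  rewrite -exprVn ler_sqr ?nnegrE ?exprn_ge0 ?expR_ge0 ?invr_ge0 //.
  by rewrite lerXn2r ?nnegrE ?expR_ge0 ?invr_ge0.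
rewrite -exprM -expRM_natr ler_expR natrM; lra.
Qed.
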